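(* Let $\Gamma=(N,(Y_i,u_i)_{i\in N})$ be a finite normal form game in which all players have the same action set ($Y_i=Y_j$ for all $i,j$), and in which the utility functions are identical and permutation invariant: $u_i=u_j=:u$ for all $i,j\in N$, and $u([y']_i,[y'']_j,y_{-(i,j)})=u([y'']_i,[y']_j,y_{-(i,j)})$ for all $i,j\in N$, all actions $y',y''$, and all actions $y_{-(i,j)}$ of the players other than $i,j$, where $[y']_k$ denotes action $y'$ being played by player $k$. Let $\Psi$ be an instance of empirical centroid fictitious play (ECFP) with convergence maps $f_i^\xi$, and suppose that the strongly convergent variant of $\Psi$ (defined in the context) is such that, almost surely, $\lim_{t\to\infty}\rho_i(t)=0$ for all $i\in N$, $\sum_{t\ge1}\rho_i(t)=\infty$ for all $i\in N$, and $\lim_{t\to\infty}\frac{\sum_{k=1}^t\rho_i(k)}{\sum_{k=1}^t\rho_j(k)}=1$ for all $i,j\in N$, and that its best-response errors satisfy $\lim_{t\to\infty}\eta_t=0$. Let $g(t)=(g_1(t),\dots,g_n(t))$ be its period-by-period mixed strategies. (i) If $f_i^\xi(q)=\frac1n\sum_{j\in N}q_j$ for all $i$, then $\lim_{t\to\infty}d(g(t),C)=0$ almost surely, where $C$ is the set of consensus Nash equilibria. (ii) If $f_i^\xi(q)=q_i$ for all $i$, then $\lim_{t\to\infty}d(g(t),MCE)=0$ almost surely, where $MCE$ is the set of mean-centric equilibria.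
   Context: Game notation. $N=\{1,\dots,n\}$, finite action sets $Y_i$ of cardinality $m_i$, utilities $u_i:Y\to\mathbb R$, $Y=\prod_iY_i$. $\Delta_i$ is the simplex of probability vectors in $\mathbb R^{m_i}$, $A_i=\{e_1,\dots,e_{m_i}\}\subset\Delta_i$ the pure strategies (standard basis vectors), $\Delta^n=\prod_i\Delta_i$. $U_i(p)=\sum_{y\in Y}u_i(y)p_1(y_1)\cdots p_n(y_n)$. $NE=\{p\in\Delta^n:U_i(p_i,p_{-i})\ge U_i(p_i',p_{-i})\ \forall p_i'\in\Delta_i,\forall i\}$. For $\epsilon\ge0$, $BR_i^\epsilon(p_{-i})=\{a_i\in A_i:U_i(a_i,p_{-i})\ge\max_{\alpha_i\in A_i}U_i(\alpha_i,p_{-i})-\epsilon\}$. $d(p,S)=\inf_{p'\in S}\|p-p'\|$ (Euclidean norm). For $p\in\Delta^n$ (with identical action sets), $\bar p=\frac1n\sum_{j}p_j$ and $\bar p_{-i}=(\bar p,\dots,\bar p)$ ($n-1$ copies, one for each player $j\ne i$). Consensus Nash equilibria: $C=\{p\in NE:p_1=p_2=\dots=p_n\}$. Mean-centric equilibria: $MCE=\{p\in\Delta^n:U_i(p_i,\bar p_{-i})\ge U_i(p_i',\bar p_{-i})\ \forall p_i'\in\Delta_i,\forall i\}$. ECFP. A process of joint actions with $q_i(t)=\frac1t\sum_{s=1}^ta_i(s)$, $\bar q(t)=\frac1n\sum_iq_i(t)$, and $a_i(t+1)\in BR_i^{\epsilon_t}(\bar q_{-i}(t))$ for all $i$ and $t\ge1$,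 where $\epsilon_t\to0$. Strongly convergent variant of ECFP. A random process with random variables $X_i(t)\in\{0,1\}$ ($X_i(t)=1$ meaning that player $i$ plays a deliberate best response in round $t$), actions $a_i(t)\in A_i$ and selections $b_i(t)\in A_i$. Initialization: $a_i(1)$ arbitrary, $X_i(1)=1$ for all $i$. With $\ell_i(t)=\sum_{k=1}^tX_i(k)$, the empirical distribution $q_i(t)=\frac1{\ell_i(t)}\sum_{k\le t:\,X_i(k)=1}a_i(k)$ averages player $i$'s actions over rounds of deliberate best response; $q(t)=(q_1(t),\dots,q_n(t))$, $\bar q(t)=\frac1n\sum_iq_i(t)$, $\xi_i(t)=f_i^\xi(q(t))$. For $t\ge2$, $b_i(t-1)\in BR_i^{\eta_t}(\bar q_{-i}(t-1))$, where $(\eta_t)$ is a sequence of nonnegative numbers; the action is $a_i(t)=b_i(t-1)$ if $X_i(t)=1$, while if $X_i(t)=0$, $a_i(t)$ is drawn at random from the distribution $\xi_i(t-1)$. With $\mathcal F_t=\sigma(\{a(s),X_1(s),\dots,X_n(s),b_1(s),\dots,b_n(s)\}_{s\le t})$, define $\rho_i(t)=\mathbb P(X_i(t)=1\mid\mathcal F_{t-1})$ and $g_i(t)=\rho_i(t)\,b_i(t-1)+(1-\rho_i(t))\,\xi_i(t-1)$, so that $g_i(t)$ is the conditional distribution of $a_i(t)$ given $\mathcal F_{t-1}$. *)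

(* Defs.v *)
From HB Require Import structures.
From mathcomp Require Import all_boot all_order all_algebra.
From mathcomp Require Import all_classical all_reals all_analysis.
Set Implicit Arguments.
Unset Strict Implicit.
Unset Printing Implicit Defensive.
Import Order.TTheory GRing.Theory Num.Theory.
Import numFieldNormedType.Exports.
Local Open Scope classical_set_scope.
Local Open Scope ring_scope.

(* All players have the same action set [Y].  A player's mixed strategy is a
   function on [Y], and membership in the simplex is the separate predicate
   [simplex]; the pure strategy e_y is [pure y]. *)
Definition strategy (R : realType) (Y : finType) : Type := Y -> R.

Definition profile (R : realType) (n : nat) (Y : finType) : Type :=
  'I_n -> strategy R Y.

Definition utilities (R : realType) (n : nat) (Y : finType) : Type :=
  'I_n -> {ffun 'I_n -> Y} -> R.

Definition simplex (R : realType) (Y : finType) : set (strategy R Y) :=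
  [set x | (forall y, 0 <= x y) /\ \sum_(y : Y) x y = 1].

Definition pure (R : realType) (Y : finType) (y : Y) : strategy R Y :=
  fun z => (z == y)%:R.

Definition mixed_profiles (R : realType) (n : nat) (Y : finType) :
    set (profile R n Y) :=
  [set p | forall i, simplex (p i)].

Definition mixed_utility (R : realType) (n : nat) (Y : finType)
    (u : utilities R n Y) (i : 'I_n) (p : profile R n Y) : R :=
  \sum_(y : {ffun 'I_n -> Y}) u i y * \prod_(j < n) p j (y j).

(* The profile (x, p_{-i}); the component [p i] is ignored. *)
Definition deviate (R : realType) (n : nat) (Y : finType)
    (p : profile R n Y) (i : 'I_n) (x : strategy R Y) : profile R n Y :=
  fun j => if j == i then x else p j.

Definition NE (R : realType) (n : nat) (Y : finType) (u : utilities R n Y) :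
    set (profile R n Y) :=
  [set p | mixed_profiles p /\
    forall i x, simplex x ->
      mixed_utility u i (deviate p i (p i)) >= mixed_utility u i (deviate p i x)].

Definition BR (R : realType) (n : nat) (Y : finType) (u : utilities R n Y)
    (eps : R) (i : 'I_n) (p : profile R n Y) : set Y :=
  [set y | forall z : Y,
    mixed_utility u i (deviate p i (pure R y)) >=
      mixed_utility u i (deviate p i (pure R z)) - eps].

Definition centroid (R : realType) (n : nat) (Y : finType)
    (p : profile R n Y) : strategy R Y :=
  fun y => n%:R^-1 * \sum_(j < n) p j y.

(* All players use the centroid; [deviate (centroid_profile p) i x] is then
   the profile (x, \bar p_{-i}). *)
Definition centroid_profile (R : realType) (n : nat) (Y : finType)
    (p : profile R n Y) : profile R n Y :=
  fun _ => centroid p.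

Definition consensus_NE (R : realType) (n : nat) (Y : finType)
    (u : utilities R n Y) : set (profile R n Y) :=
  [set p | NE u p /\ forall i j, p i = p j].

Definition MCE (R : realType) (n : nat) (Y : finType) (u : utilities R n Y) :
    set (profile R n Y) :=
  [set p | mixed_profiles p /\
    forall i x, simplex x ->
      mixed_utility u i (deviate (centroid_profile p) i (p i)) >=
        mixed_utility u i (deviate (centroid_profile p) i x)].

Definition euclidean_dist (R : realType) (n : nat) (Y : finType)
    (p q : profile R n Y) : R :=
  Num.sqrt (\sum_(i < n) \sum_(y : Y) (p i y - q i y) ^+ 2).

(* Extended-real valued, so that the distance to the empty set is +oo; the
   infimum [inf] of the real numbers would make it 0. *)
Definition dist_to (R : realType) (n : nat) (Y : finType)
    (p : profile R n Y) (S : set (profile R n Y)) : \bar R :=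
  ereal_inf [set (euclidean_dist p q)%:E | q in S].

Definition identical_utilities (R : realType) (n : nat) (Y : finType)
    (u : utilities R n Y) : Prop :=
  forall i j y, u i y = u j y.

Definition play2 (n : nat) (Y : finType) (y : {ffun 'I_n -> Y})
    (i : 'I_n) (yi : Y) (j : 'I_n) (yj : Y) : {ffun 'I_n -> Y} :=
  [ffun k => if k == i then yi else if k == j then yj else y k].

Definition permutation_invariant (R : realType) (n : nat) (Y : finType)
    (u : utilities R n Y) : Prop :=
  forall (k i j : 'I_n) (y' y'' : Y) (y : {ffun 'I_n -> Y}), i != j ->
    u k (play2 y i y' j y'') = u k (play2 y i y'' j y').

(* [rho] is a version of the conditional probability of [E] given the
   sigma-algebra [F]. *)
Definition is_cond_prob (R : realType) (d : measure_display)
    (Omega : measurableType d) (P : probability Omega R)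
    (F : set (set Omega)) (E : set Omega) (rho : Omega -> R) : Prop :=
  [/\ forall B : set R, measurable B -> F (rho @^-1` B),
      P.-integrable setT (EFin \o rho) &
      forall A, F A -> (\int[P]_(w in A) (rho w)%:E = P (A `&` E))%E].

(* Rounds are numbered from 1; the values of a process at time 0 are never
   constrained, and only influence quantities that are themselves
   irrelevant. *)

(* The sigma-algebra generated by the actions, the activation variables and the
   selections of the rounds 1, ..., t; it is trivial for t = 0. *)
Definition history (n : nat) (Y : finType) (Omega : Type)
    (X : nat -> 'I_n -> Omega -> bool) (a b : nat -> 'I_n -> Omega -> Y)
    (t : nat) : set (set Omega) :=
  <<s [set E | exists (s : nat) (i : 'I_n), (1 <= s <= t)%N /\
        [\/ exists y, E = [set w | a s i w = y],
            E = [set w | X s i w] |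
            exists y, E = [set w | b s i w = y]]] >>.

Definition num_deliberate (n : nat) (Omega : Type)
    (X : nat -> 'I_n -> Omega -> bool) (t : nat) (i : 'I_n) (w : Omega) : nat :=
  (\sum_(1 <= k < t.+1) X k i w)%N.

Definition empirical (R : realType) (n : nat) (Y : finType) (Omega : Type)
    (X : nat -> 'I_n -> Omega -> bool) (a : nat -> 'I_n -> Omega -> Y)
    (t : nat) (w : Omega) : profile R n Y :=
  fun i y => (num_deliberate X t i w)%:R^-1 *
    \sum_(1 <= k < t.+1 | X k i w) pure R (a k i w) y.

(* The strategies xi(t) obtained from the convergence maps [f]. *)
Definition intermediate (R : realType) (n : nat) (Y : finType) (Omega : Type)
    (f : 'I_n -> profile R n Y -> strategy R Y)
    (X : nat -> 'I_n -> Omega -> bool) (a : nat -> 'I_n -> Omega -> Y)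
    (t : nat) (w : Omega) : profile R n Y :=
  fun i => f i (empirical R X a t w).

(* g(t), which is meaningful for t >= 2. *)
Definition period_strategy (R : realType) (n : nat) (Y : finType)
    (Omega : Type) (f : 'I_n -> profile R n Y -> strategy R Y)
    (X : nat -> 'I_n -> Omega -> bool) (a b : nat -> 'I_n -> Omega -> Y)
    (rho : nat -> 'I_n -> Omega -> R) (t : nat) (w : Omega) : profile R n Y :=
  fun i y => rho t i w * pure R (b t.-1 i w) y +
    (1 - rho t i w) * intermediate f X a t.-1 w i y.

(* Given the past and the event X_i(t) = 0, the action a_i(t) has law
   xi_i(t-1): this is [draw], stated in integrated form over the events of
   the past.  No joint law across players is imposed. *)
Record strongly_convergent_ECFP (R : realType) (n : nat) (Y : finType)
    (d : measure_display) (Omega : measurableType d) (P : probability Omega R)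
    (u : utilities R n Y) (f : 'I_n -> profile R n Y -> strategy R Y)
    (eta : nat -> R) (X : nat -> 'I_n -> Omega -> bool)
    (a b : nat -> 'I_n -> Omega -> Y) (rho : nat -> 'I_n -> Omega -> R) : Prop := {
  convergence_maps : forall i q, mixed_profiles q -> simplex (f i q);
  measurable_actions : forall t i y, (1 <= t)%N ->
    measurable [set w | a t i w = y];
  measurable_activations : forall t i, (1 <= t)%N ->
    measurable [set w | X t i w];
  measurable_selections : forall t i y, (1 <= t)%N ->
    measurable [set w | b t i w = y];
  errors_ge0 : forall t, (2 <= t)%N -> 0 <= eta t;
  initialization : forall i w, X 1 i w = true;
  selection : forall t i w, (2 <= t)%N ->
    BR u (eta t) i (centroid_profile (empirical R X a t.-1 w)) (b t.-1 i w);
  deliberate : forall t i w, (2 <= t)%N -> X t i w = true ->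
    a t i w = b t.-1 i w;
  draw : forall t i y A, (2 <= t)%N -> history X a b t.-1 A ->
    (P (A `&` [set w | X t i w = false] `&` [set w | a t i w = y]) =
     \int[P]_(w in A `&` [set w | X t i w = false])
        (intermediate f X a t.-1 w i y)%:E)%E;
  activation_prob : forall t i, (1 <= t)%N ->
    is_cond_prob P (history X a b t.-1) [set w | X t i w] (rho t i)
}.

(* Main.v *)
Require Import Defs.
From HB Require Import structures.
From mathcomp Require Import all_boot all_order all_algebra.
From mathcomp Require Import all_classical all_reals all_analysis.
From mathcomp Require Import perm generic_quotient ring_quotient.
From mathcomp Require Import measurable_realfun.
From mathcomp Require Import ring lra.
Import Order.TTheory GRing.Theory Num.Theory.
Import numFieldNormedType.Exports.
Local Open Scope classical_set_scope.
Local Open Scope ring_scope.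
Set Implicit Arguments.
Unset Strict Implicit.
Unset Printing Implicit Defensive.

(* By a law of large numbers for conditional probabilities, the number l_i(t) of
   deliberate rounds of player i is almost surely equivalent to the sum of the
   rho_i(k), so that the counts of any two players are equivalent and the
   centroid is asymptotic to the frequency r(t) of the deliberate actions of all
   the players pooled together.  Since all players have the same best responses
   to a centroid, r(t) is a perturbed best-response process for the potential
   V(x) = U(x, ..., x): a step of size gamma raises V by at least
   gamma (n gap(r) - o(1)), where gap(x) is the best payoff against x minus
   V(x).  The errors need not be summable, hence one needs that V takes finitely
   many values on the zeros of the gap.  This is Sard's theorem for a polynomial,
   proved algebraically: otherwise V takes, at a zero of the gap in an
   ultrapower F of R, a value that is transcendental over R, so some derivation
   of a subring of F that vanishes on R does not vanish at this value, while the
   first order conditions force it to.  Then V(r(t)) converges, the gap of r(t)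
   tends to 0, and compactness gives the convergence of distances.  For (ii),
   q_i <= n qbar bounds the gap of q_i against qbar by n times that of qbar. *)

(** * Extension of derivations *)

(** The obstacle is that errors which merely tend to 0 can add up to an unbounded loss, so the
    potential could slide down forever through a continuum of critical values. On an interval free
    of critical values the ascent rate is bounded below, which beats any o(1) error; hence the
    finiteness of the set of critical values. Stationarity passes to the ultrapower because it is a
    family of product identities x_z (lam - W_z) = 0. A ring without zero divisors suffices to read
    them, and derivations are extended there up to a nonzero factor, which replaces division by
    p'(x). Pooling is used because the frequencies q_i move with the separate step sizes 1 / l_i(t),
    while the pooled frequency moves with one. The law of large numbers rests on second moments: the
    compensated count stopped when its compensator reaches the level j^2 has variance at most j^2,
    so it exceeds e j^2 with probability at most 1 / (e j)^2, which is summable in j; monotonicity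
    of counts and compensators fills in between consecutive squares. *)

Definition is_subring (F : nzRingType) (A : F -> Prop) : Prop :=
  [/\ A 1, forall x y, A x -> A y -> A (x - y) &
      forall x y, A x -> A y -> A (x * y)].

(** [D] is a total function constrained only on [A], so that extending a derivation means enlarging
    the predicate [A] inside a fixed ring. *)
Definition is_derivation (F : nzRingType) (A : F -> Prop) (D : F -> F) : Prop :=
  [/\ is_subring A, forall x y, A x -> A y -> D (x + y) = D x + D y &
      forall x y, A x -> A y -> D (x * y) = D x * y + x * D y].

Definition coefs_in (F : nzRingType) (A : F -> Prop) (p : {poly F}) : Prop :=
  forall i, A p`_i.

Section Subring.
Context {F : nzRingType} {A : F -> Prop} (hA : is_subring A).

Lemma is_subring0 : A 0.
Proof. by case: hA => A1 AB _; rewrite -(subrr 1); exact: AB. Qed.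

Lemma is_subringN x : A x -> A (- x).
Proof. by case: hA => _ AB _ Ax; rewrite -sub0r; apply: AB => //; exact: is_subring0. Qed.

Lemma is_subringD x y : A x -> A y -> A (x + y).
Proof.
by case: hA => _ AB _ Ax Ay; rewrite -(opprK y); apply: AB => //; exact: is_subringN.
Qed.

Lemma is_subring_sum I (r : seq I) (P : pred I) (G : I -> F) :
  (forall i, P i -> A (G i)) -> A (\sum_(i <- r | P i) G i).
Proof.
move=> AG; elim/big_rec: _ => [|i x Pi Ax]; first exact: is_subring0.
by apply: is_subringD => //; exact: AG.
Qed.

Lemma is_subring_prod I (r : seq I) (P : pred I) (G : I -> F) :
  (forall i, P i -> A (G i)) -> A (\prod_(i <- r | P i) G i).
Proof.
case: hA => A1 _ AM AG; elim/big_rec: _ => [//|i x Pi Ax].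
by apply: AM => //; exact: AG.
Qed.

Lemma coefs_inB p q : coefs_in A p -> coefs_in A q -> coefs_in A (p - q).
Proof. by case: hA => _ AB _ Ap Aq i; rewrite coefB; exact: AB. Qed.

Lemma coefs_inD p q : coefs_in A p -> coefs_in A q -> coefs_in A (p + q).
Proof. by move=> Ap Aq i; rewrite coefD; exact: is_subringD. Qed.

Lemma coefs_inM p q : coefs_in A p -> coefs_in A q -> coefs_in A (p * q).
Proof.
case: hA => _ _ AM Ap Aq i; rewrite coefM; apply: is_subring_sum => j _.
exact: AM.
Qed.

Lemma coefs_inC a : A a -> coefs_in A a%:P.
Proof.
by move=> Aa i; rewrite coefC; case: eqP => // _; exact: is_subring0.
Qed.

Lemma coefs_inX : coefs_in A 'X.
Proof.
move=> i; rewrite coefX; case: eqP => // _; last exact: is_subring0.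
by case: hA.
Qed.

Lemma coefs_inXn n : coefs_in A 'X^n.
Proof.
move=> i; rewrite coefXn; case: eqP => // _; last exact: is_subring0.
by case: hA.
Qed.

Lemma coefs_in_deriv p : coefs_in A p -> coefs_in A p^`().
Proof.
move=> Ap i; rewrite coef_deriv -mulr_natr; case: (hA) => A1 _ AM.
apply: AM => //; elim: i.+1 => [|n IH]; first exact: is_subring0.
by rewrite -natr1; exact: is_subringD.
Qed.
End Subring.

Section Derivation.
Context {F : comNzRingType} {A : F -> Prop} {D : F -> F} (hD : is_derivation A D).

Let hA : is_subring A. Proof. by case: hD. Qed.

Lemma derivation0 : D 0 = 0.
Proof.
case: hD => _ DD _; have := DD _ _ (is_subring0 hA) (is_subring0 hA).
by rewrite addr0 => /(congr1 (fun z => z - D 0)); rewrite subrr addrK.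
Qed.

Lemma derivationN x : A x -> D (- x) = - D x.
Proof.
case: hD => _ DD _ Ax; apply/eqP; rewrite -addr_eq0 addrC; apply/eqP.
by rewrite -DD ?subrr ?derivation0 //; exact: is_subringN.
Qed.

Lemma derivation1 : D 1 = 0.
Proof.
case: hD => -[A1 _ _] _ DM; have := DM 1 1 A1 A1.
by rewrite !mulr1 mul1r => /(congr1 (fun z => z - D 1)); rewrite subrr addrK.
Qed.

Lemma derivation_sum I (r : seq I) (P : pred I) (G : I -> F) :
  (forall i, P i -> A (G i)) ->
  D (\sum_(i <- r | P i) G i) = \sum_(i <- r | P i) D (G i).
Proof.
case: hD => _ DD _ AG; elim: r => [|i r IH]; first by rewrite !big_nil derivation0.
rewrite !big_cons; case: ifP => // Pi.
by rewrite DD ?IH //; [exact: AG|exact: is_subring_sum].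
Qed.

Lemma derivation_prod (I : finType) (G : I -> F) : (forall i, A (G i)) ->
  D (\prod_i G i) = \sum_i D (G i) * \prod_(j | j != i) G j.
Proof.
move=> AG; case: (hD) => _ DD DM.
(* Generalized to duplicate-free lists: with repetitions the filter [j != i] would remove every copy
   of [i], and the Leibniz formula would fail. *)
suff H (r : seq I) : uniq r -> D (\prod_(i <- r) G i) =
    \sum_(i <- r) D (G i) * \prod_(j <- r | j != i) G j.
  by have := H (index_enum I) (index_enum_uniq I).
elim: r => [|i r IH] /=; first by rewrite !big_nil derivation1.
case/andP=> inr ur; rewrite !big_cons DM ?IH //; last exact: is_subring_prod.
rewrite eqxx /=; congr (_ + _).
  by congr (_ * _); rewrite big_seq_cond [RHS]big_seq_cond; apply: eq_bigl => j;
    case jr: (j \in r) => //=; case: eqP jr inr => // ->  ->.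
rewrite big_distrr /= big_seq [RHS]big_seq; apply: eq_bigr => j jr.
rewrite big_cons mulrCA; case: eqP => [ij|//]; by rewrite ij jr in inr.
Qed.

(* [f(x) |-> s * f^D(x) + c * f'(x)] is the extension of [s * D] to [A[x]]
   with [x |-> c]; it has to vanish on the polynomials that vanish at [x]. *)
Definition poly_derivation (s c x : F) (p : {poly F}) : F :=
  s * (map_poly D p).[x] + c * p^`().[x].

Lemma coef_map_derivation p i : (map_poly D p)`_i = D p`_i.
Proof. by rewrite coef_map_id0 // derivation0. Qed.

Lemma poly_derivationB s c x p q : coefs_in A p -> coefs_in A q ->
  poly_derivation s c x (p - q) = poly_derivation s c x p - poly_derivation s c x q.
Proof.
move=> Ap Aq; rewrite /poly_derivation derivB.
have -> : map_poly D (p - q) = map_poly D p - map_poly D q.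
  apply/polyP => i; rewrite coefB !coef_map_derivation coefB.
  by case: hD => _ DD _; rewrite DD ?derivationN //; exact: is_subringN.
by rewrite !(hornerD, hornerN) !mulrBr opprD addrACA.
Qed.

Lemma poly_derivationD s c x p q : coefs_in A p -> coefs_in A q ->
  poly_derivation s c x (p + q) = poly_derivation s c x p + poly_derivation s c x q.
Proof.
move=> Ap Aq; rewrite /poly_derivation derivD.
have -> : map_poly D (p + q) = map_poly D p + map_poly D q.
  apply/polyP => i; rewrite coefD !coef_map_derivation coefD.
  by case: hD => _ DD _; rewrite DD.
by rewrite !hornerD !mulrDr addrACA.
Qed.

Lemma poly_derivationM s c x p q : coefs_in A p -> coefs_in A q ->
  poly_derivation s c x (p * q) =
    poly_derivation s c x p * q.[x] + p.[x] * poly_derivation s c x q.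
Proof.
move=> Ap Aq; rewrite /poly_derivation derivM.
have -> : map_poly D (p * q) = map_poly D p * q + p * map_poly D q.
  apply/polyP => i; rewrite coefD !coef_map_derivation !coefM.
  case: hD => -[A1 AB AM] DD DM.
  rewrite derivation_sum; last by move=> j _; exact: AM.
  rewrite -big_split /=; apply: eq_bigr => j _.
  by rewrite !coef_map_derivation DM.
rewrite !(hornerD, hornerM); ring.
Qed.

Lemma poly_derivationC s c x a : poly_derivation s c x a%:P = s * D a.
Proof.
rewrite /poly_derivation derivC horner0 mulr0 addr0; congr (_ * _).
have -> : map_poly D a%:P = (D a)%:P.
  apply/polyP => i; rewrite coef_map_derivation !coefC; case: eqP => // _.
  exact: derivation0.
by rewrite hornerC.
Qed.

Lemma poly_derivation0 s c x : poly_derivation s c x 0 = 0.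
Proof. by rewrite -polyC0 poly_derivationC derivation0 mulr0. Qed.

Lemma poly_derivationX s c x : poly_derivation s c x 'X = c.
Proof.
rewrite /poly_derivation derivX hornerC mulr1.
have -> : map_poly D 'X = 0.
  apply/polyP => i; rewrite coef_map_derivation coefX coef0; case: eqP => // _.
    exact: derivation1.
  exact: derivation0.
by rewrite horner0 mulr0 add0r.
Qed.

(** The hypothesis makes the value at an element of A[x] independent of the polynomial chosen to
    represent it, hence additive and Leibniz because [poly_derivation] is. *)
Lemma derivation_extend_with s c x :
  (forall p, coefs_in A p -> p.[x] = 0 -> poly_derivation s c x p = 0) ->
  exists (A' : F -> Prop) (D' : F -> F), [/\ is_derivation A' D',
    (forall a, A a -> A' a), A' x, (forall a, A a -> D' a = s * D a) & D' x = c].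
Proof.
move=> H.
pose A' y := exists p, coefs_in A p /\ p.[x] = y.
pose rep y := if pselect (A' y) is left h then projT1 (cid h) else 0.
have repP y : A' y -> coefs_in A (rep y) /\ (rep y).[x] = y.
  by move=> h; rewrite /rep; case: pselect => // h'; case: cid.
have D'E p : coefs_in A p ->
    poly_derivation s c x (rep p.[x]) = poly_derivation s c x p.
  move=> Ap; have [Ar rE] := repP p.[x] (ex_intro _ p (conj Ap erefl)).
  apply/eqP; rewrite -subr_eq0 -poly_derivationB //; apply/eqP; apply: H.
    exact: coefs_inB.
  by rewrite !hornerE rE subrr.
exists A', (fun y => poly_derivation s c x (rep y)).
split.
- split.
  + split.
    * exists 1%:P; rewrite hornerC; split => //; apply: (coefs_inC hA).
      by case: hA.
    * move=> _ _ [p [Ap <-]] [q [Aq <-]]; exists (p - q); split.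
        exact: coefs_inB.
      by rewrite !hornerE.
    * move=> _ _ [p [Ap <-]] [q [Aq <-]]; exists (p * q); split.
        exact: coefs_inM.
      by rewrite !hornerE.
  + move=> _ _ [p [Ap <-]] [q [Aq <-]].
    rewrite -hornerD !D'E ?poly_derivationD //; exact: coefs_inD.
  + move=> _ _ [p [Ap <-]] [q [Aq <-]].
    rewrite -hornerM !D'E ?poly_derivationM //; exact: coefs_inM.
- move=> a Aa; exists a%:P; split; [exact: coefs_inC|by rewrite hornerC].
- by exists 'X; split; [exact: coefs_inX|rewrite hornerX].
- move=> a Aa; have := D'E _ (coefs_inC hA Aa).
  by rewrite hornerC poly_derivationC.
- by have := D'E _ (coefs_inX hA); rewrite hornerX poly_derivationX.
Qed.

(** If [x] is transcendental over [A], its derivative is free. Otherwise a polynomial [p] of least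
    degree vanishing at [x] forces the derivative -p^D(x) / p'(x); multiplying the whole derivation
    by s = p'(x) removes the division. *)
Lemma derivation_extend x :
  (forall y z : F, y * z = 0 -> y = 0 \/ z = 0) ->
  (forall k, k.+1%:R != 0 :> F) ->
  exists (A' : F -> Prop) (D' : F -> F) (s : F), [/\ is_derivation A' D',
    (forall a, A a -> A' a), A' x, s != 0 & forall a, A a -> D' a = s * D a].
Proof.
move=> dom char0.
have [[p0 [Ap0 p0x p0n0]]|ntr] :=
    pselect (exists p, [/\ coefs_in A p, p.[x] = 0 & p != 0]); last first.
  have [|A' [D' [h1 h2 h3 h4 _]]] := @derivation_extend_with 1 0 x.
    move=> p Ap px; case: (eqVneq p 0) => [->|pn0]; last by exfalso; apply: ntr; exists p.
    exact: poly_derivation0.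
  by exists A', D', 1; split => //; exact: oner_neq0.
pose Q m := `[< exists p, [/\ coefs_in A p, p.[x] = 0, p != 0 & size p = m] >].
have exQ : exists m, Q m by exists (size p0); apply/asboolP; exists p0.
case: (ex_minnP exQ) => m /asboolP [p [Ap px pn0 sp]] minm.
have min q : coefs_in A q -> q.[x] = 0 -> q != 0 -> (size p <= size q)%N.
  by move=> Aq qx qn0; rewrite sp; apply: minm; apply/asboolP; exists q.
have sp2 : (1 < size p)%N.
  rewrite ltnNge; apply/negP => /size1_polyC pE.
  by move: px pn0; rewrite pE hornerC => ->; rewrite eqxx.
(* Characteristic 0: the top coefficient of the derivative is a positive integer times the leading
   coefficient of [p]. Minimality of [p] then gives p'(x) != 0. *)
have dp0 : p^`() != 0.
  apply/negP => /eqP /polyP /(_ (size p).-2).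
  have sp1 : (size p).-2.+1 = (size p).-1 by rewrite prednK // -subn1 subn_gt0.
  rewrite coef_deriv coef0 {1}sp1.
  rewrite -mulr_natr => /dom[|/eqP]; last by apply/negP; exact: char0.
  by rewrite -lead_coefE => /eqP; rewrite lead_coef_eq0 (negbTE pn0).
have dpx : p^`().[x] != 0.
  apply/negP => /eqP dpx0.
  have := min _ (coefs_in_deriv hA Ap) dpx0 dp0.
  by rewrite leqNgt lt_size_deriv.
pose s := p^`().[x]; pose c := - (map_poly D p).[x].
have Ep : poly_derivation s c x p = 0.
  by rewrite /poly_derivation /s /c mulNr mulrC subrr.
(* Pseudo-division by [p]: the polynomial [r] below has lower degree than [q] and still vanishes at
   [x]. Since [poly_derivation] kills [p], its value at [r] is the leading coefficient of [p] times
   its value at [q]. *)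
have key q : coefs_in A q -> q.[x] = 0 -> poly_derivation s c x q = 0.
  have [k] := ubnP (size q); elim: k q => // k IH q; rewrite ltnS => sq Aq qx.
  case: (eqVneq q 0) => [->|qn0].
    exact: poly_derivation0.
  have spq := min q Aq qx qn0.
  pose r := (lead_coef p)%:P * q - (lead_coef q)%:P * 'X^(size q - size p) * p.
  have Alp : A (lead_coef p) by exact: Ap.
  have Alq : A (lead_coef q) by exact: Aq.
  have Ar1 : coefs_in A ((lead_coef p)%:P * q).
    by apply: coefs_inM => //; exact: coefs_inC.
  have Ar0 : coefs_in A ((lead_coef q)%:P * 'X^(size q - size p)).
    by apply: coefs_inM => //; [exact: coefs_inC|exact: coefs_inXn].
  have Ar2 : coefs_in A ((lead_coef q)%:P * 'X^(size q - size p) * p).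
    exact: coefs_inM.
  have rx : r.[x] = 0 by rewrite /r !hornerE px qx !mulr0 subrr.
  have sr : (size r < size q)%N.
    have sq0 : (0 < size q)%N by rewrite size_poly_gt0.
    have : (size r <= (size q).-1)%N.
      apply/leq_sizeP => j hj; rewrite /r coefB -mulrA !coefCM coefXnM.
      have spos : (0 < size p)%N by exact: ltnW.
      have [jq|jq] := eqVneq j (size q).-1.
        have -> : (j < size q - size p)%N = false.
          apply/negbTE; rewrite -leqNgt jq -subn1; apply: leq_sub2l.
          exact: spos.
        have -> : (j - (size q - size p))%N = (size p).-1.
          rewrite jq -!subn1 -subnDA addnC subnDA subKn //.
        by rewrite jq -!lead_coefE mulrC subrr.
      have jq2 : (size q <= j)%N.
        by rewrite -(prednK sq0) ltn_neqAle eq_sym jq.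
      rewrite nth_default // mulr0 sub0r.
      have -> : (j < size q - size p)%N = false.
        by apply/negbTE; rewrite -leqNgt (leq_trans _ jq2) // leq_subr.
      rewrite [X in _ * X]nth_default ?mulr0 ?oppr0 //.
      by rewrite leq_subRL ?(leq_trans _ jq2) ?leq_subr // subnK.
    by move=> h; rewrite -(prednK sq0) ltnS.
  have Er : poly_derivation s c x r = 0.
    by apply: IH => //; [exact: leq_trans sr sq | exact: coefs_inB].
  move: Er; rewrite /r poly_derivationB // (poly_derivationM _ _ _ Ar0 Ap).
  rewrite px Ep !mulr0 addr0 subr0 poly_derivationM //; last exact: coefs_inC.
  rewrite qx mulr0 add0r hornerC => /dom[/eqP|//].
  by rewrite lead_coef_eq0 (negbTE pn0).
have [A' [D' [h1 h2 h3 h4 _]]] := derivation_extend_with key.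
by exists A', D', s; split.
Qed.

End Derivation.

Lemma derivation_extend_seq (F : comNzRingType) (A : F -> Prop) (D : F -> F)
    (xs : seq F) :
  (forall y z : F, y * z = 0 -> y = 0 \/ z = 0) ->
  (forall k, k.+1%:R != 0 :> F) -> is_derivation A D ->
  exists (A' : F -> Prop) (D' : F -> F) (s : F), [/\ is_derivation A' D',
    (forall a, A a -> A' a), (forall x, x \in xs -> A' x), s != 0 &
    forall a, A a -> D' a = s * D a].
Proof.
move=> dom char0; elim: xs A D => [|x xs IH] A D hD.
  by exists A, D, 1; split => // [|a _]; rewrite ?oner_neq0 ?mul1r.
have [A1 [D1 [s1 [hD1 AA1 A1x s1n0 D1E]]]] := derivation_extend hD x dom char0.
have [A2 [D2 [s2 [hD2 AA2 A2x s2n0 D2E]]]] := IH _ _ hD1.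
exists A2, D2, (s2 * s1); split => //.
- by move=> a Aa; apply: AA2; exact: AA1.
- by move=> y; rewrite inE => /orP[/eqP ->|]; [exact: AA2|exact: A2x].
- by apply/eqP => /dom[] /eqP; exact/negP.
- by move=> a Aa; rewrite D2E ?D1E ?mulrA //; exact: AA1.
Qed.

(** Transcendence leaves no polynomial relation to respect, so the zero derivation on the image of
    [K] extends with derivative 1 at [x]. Adjoining [ys] then only multiplies this 1 by a nonzero
    factor. *)
Lemma derivation_of_transcendental (F : comNzRingType) (K : nzRingType)
    (iota : {rmorphism K -> F}) (x : F) (ys : seq F) :

  (forall y z : F, y * z = 0 -> y = 0 \/ z = 0) ->
  (forall k, k.+1%:R != 0 :> F) ->
  (forall p : {poly K}, (map_poly iota p).[x] = 0 -> p = 0) ->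
  exists (A : F -> Prop) (D : F -> F), [/\ is_derivation A D,
    (forall k, A (iota k) /\ D (iota k) = 0),
    A x, (forall y, y \in ys -> A y) & D x != 0].
Proof.
move=> dom char0 tr.
pose A0 y := exists k, iota k = y.
have hD0 : is_derivation A0 (fun=> 0).
  split.
  - split; first by exists 1; rewrite rmorph1.
    + by move=> _ _ [k <-] [l <-]; exists (k - l); rewrite rmorphB.
    + by move=> _ _ [k <-] [l <-]; exists (k * l); rewrite rmorphM.
  - by move=> *; rewrite addr0.
  - by move=> *; rewrite mul0r mulr0 addr0.
have [|A1 [D1 [hD1 AA1 A1x D1E D1x]]] := derivation_extend_with hD0 (s:=1) (c:=1) (x:=x).
  move=> p Ap px.
  suff -> : p = 0 by exact: poly_derivation0 hD0 _ _ _.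
  pose k i := projT1 (cid (Ap i)).
  have kE i : iota (k i) = p`_i by rewrite /k; case: cid.
  have pE : p = map_poly iota (\poly_(i < size p) k i).
    apply/polyP => i; rewrite coef_map coef_poly; case: ltnP => h.
      exact/esym/kE.
    by rewrite nth_default // raddf0.
  by rewrite pE (tr (\poly_(i < size p) k i)) -?pE // map_poly0.
have [A2 [D2 [s [hD2 AA2 A2x sn0 D2E]]]] := derivation_extend_seq ys dom char0 hD1.
exists A2, D2; split => //.
- move=> k; have A0k : A0 (iota k) by exists k.
  split; first by apply: AA2; apply: AA1.
  by rewrite D2E ?D1E ?mulr0 //; exact: AA1.
- exact: AA2.
- by rewrite D2E // D1x mulr1.
Qed.

(** * Values of a polynomial potential at stationary points *)

Section Ultrapower.
Local Open Scope quotient_scope.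
Context {R : realType} {U : set_system nat} (UF : UltraFilter U).
Let UFF : ProperFilter U := @ultra_proper _ _ UF.
#[local] Existing Instance UFF.

(** The proof [HU] is carried as an argument so that the ideal and prime-ideal instances, which rest
    on it, can be attached to the term [null_ideal UF]. *)
Definition null_ideal (HU : UltraFilter U) : (nat -> R) -> bool :=
  fun f => `[< U [set k | f k = 0] >].

Lemma null_idealP f : reflect (U [set k | f k = 0]) (f \in null_ideal UF).
Proof. exact: asboolP. Qed.

Lemma null_ideal_closed : idealr_closed (null_ideal UF).
Proof.
split; first by apply/null_idealP; apply: filterS filterT.
- apply/negP => /null_idealP /filter_ex [k] /= /eqP; exact/negP/oner_neq0.
- move=> h f g /null_idealP hf /null_idealP hg; apply/null_idealP.
  by apply: filterS2 hf hg => k /= fk gk; rewrite /GRing.add /GRing.mul /= fk gk mulr0 addr0.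
Qed.

(** Here the filter has to be an ultrafilter: either the zero set of [f] or its complement is large,
    and on the complement [g] vanishes wherever the product does. *)
Lemma null_ideal_prime : prime_idealr_closed (null_ideal UF).
Proof.
move=> f g /null_idealP fg; apply/orP.
have [hf|hf] := in_ultra_setVsetC [set k | f k = 0] UF.
  by left; exact/null_idealP.
right; apply/null_idealP; apply: filterS2 hf fg => k /= fk.
by move=> /eqP; rewrite mulf_eq0 => /orP[/eqP|/eqP //].
Qed.

HB.instance Definition _ := isIdealr.Build
  (nat -> R : nzRingType) (null_ideal UF) null_ideal_closed.
HB.instance Definition _ := isPrimeIdealrClosed.Build
  (nat -> R : nzRingType) (null_ideal UF) null_ideal_prime.

Lemma ultrapower_quotient :
  exists (F : comNzRingType) (q : {rmorphism (nat -> R) -> F}),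
    (forall x y : F, x * y = 0 -> x = 0 \/ y = 0) /\
    (forall f, q f = 0 <-> U [set k | f k = 0]).
Proof.
pose I : prime_idealr (nat -> R) := null_ideal UF.
pose F : comNzRingType := Quotient.quot I.
exists F, (\pi_F : {rmorphism (nat -> R) -> F}); split.
  by move=> x y /(@Quotient.rquot_IdomainAxiom _ I) /orP[] /eqP; [left|right].
move=> f; rewrite -(rmorph0 (\pi_F : {rmorphism (nat -> R) -> F})).
split=> [/eqP|h].
  by rewrite -Quotient.idealrBE subr0 => /null_idealP.
by apply/eqP; rewrite -Quotient.idealrBE subr0; apply/null_idealP.
Qed.
End Ultrapower.

Definition const_seq (R : realType) (r : R) : nat -> R := fun=> r.
HB.instance Definition _ (R : realType) :=
  GRing.isZmodMorphism.Build R (nat -> R) (@const_seq R) (fun _ _ => erefl).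
HB.instance Definition _ (R : realType) :=
  GRing.isMonoidMorphism.Build R (nat -> R) (@const_seq R)
    (erefl, fun _ _ => erefl).

(** Otherwise [size p] distinct indices would yield as many distinct roots. This is what makes the
    class of an injective sequence transcendental. *)
Lemma injective_seq_roots (R : idomainType) (p : {poly R}) (f : nat -> R) :
  injective f -> p != 0 -> exists N, forall k, (N <= k)%N -> p.[f k] != 0.
Proof.
move=> inj p0; apply: contrapT => H.
have H' N : exists k, (N <= k)%N /\ root p (f k).
  apply: contrapT => H1; apply: H; exists N => k Nk; apply/negP => pk.
  by apply: H1; exists k.
have seqs m : exists s : seq nat, [/\ uniq s, size s = m & all (fun k => root p (f k)) s].
  elim: m => [|m [s [us <- rs]]]; first by exists [::].
  have [k [ks rk]] := H' (\max_(i <- s) i).+1.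
  exists (k :: s); split => //=; last by rewrite rk.
  rewrite us andbT; apply/negP => kins; move: ks.
  by rewrite ltnNge (@leq_bigmax_seq _ s xpredT (fun i => i)).
have [s [us ss rs]] := seqs (size p).
have := max_poly_roots p0 (rs := map f s).
by rewrite all_map map_inj_uniq // size_map ss ltnn => /(_ rs us).
Qed.

Section Values.
Context {R : realType} {n : nat} {Y : finType}.
Implicit Types (v : {ffun 'I_n -> Y} -> R) (x c : Y -> R) (i j : 'I_n) (z : Y).

Definition common_value v x : R := \sum_y v y * \prod_j x (y j).

(** Both the payoff when player [i] plays [z] against [x] and the partial derivative in the
    coordinate [z] through the [i]-th factor of [common_value]. This double role identifies
    equilibrium conditions with critical point conditions. *)
Definition deviation_value v i z x : R :=
  \sum_(y : {ffun 'I_n -> Y}) v y * ((y i == z)%:R * \prod_(j | j != i) x (y j)).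

(* First order conditions for a symmetric equilibrium, with the multiplier
   [lam] for player [i]. *)
Definition stationary v x : Prop :=
  \sum_z x z = 1 /\
  forall i, exists lam, forall z, x z * (lam - deviation_value v i z x) = 0.

(* Sard's theorem for the polynomial [common_value v] on the simplex: a
   derivation of the ultrapower of [R] that vanishes on [R] kills the value of
   [common_value v] at a nonstandard stationary point, while it can be chosen
   not to kill a value that is transcendental over [R]. *)
Lemma stationary_values_not_injective v (xs : nat -> Y -> R) :
  (forall k, stationary v (xs k)) -> ~ injective (common_value v \o xs).
Proof.
move=> st inj.
(* The ultrafilter refines [\oo], so every tail of the integers is large and finitely many roots
   cannot matter. *)
have [U [UU oU]] := @ultraFilterLemma nat \oo _.
have UP : ProperFilter U := @ultra_proper _ _ UU.
have [F [q [dom qE]]] := @ultrapower_quotient R U UU.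
pose iota : {rmorphism R -> F} := q \o @const_seq R.
have inj_iota : injective iota.
  move=> r s /eqP; rewrite -subr_eq0 -rmorphB /= => /eqP /qE /filter_ex [k].
  by rewrite /const_seq /= => /eqP; rewrite subr_eq0 => /eqP.
have char0 k : k.+1%:R != 0 :> F.
  rewrite -(rmorph_nat iota) -(rmorph0 iota) (inj_eq inj_iota).
  by rewrite pnatr_eq0.
pose X z : F := q (fun k => xs k z).
pose T : F := q (common_value v \o xs).
have hornerq (p : {poly R}) : (map_poly iota p).[T] = q (fun k => p.[common_value v (xs k)]).
  rewrite (@horner_coef_wide _ (size p)) ?size_map_poly //.
  have -> : (fun k => p.[common_value v (xs k)]) =
      \sum_(i < size p) const_seq p`_i * (common_value v \o xs) ^+ i.
    apply/funext => k; rewrite horner_coef fct_sumE; apply: eq_bigr => i _.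
    by rewrite exprfctE.
  rewrite rmorph_sum; apply: eq_bigr => i _.
  by rewrite coef_map rmorphM rmorphXn.
have tr (p : {poly R}) : (map_poly iota p).[T] = 0 -> p = 0.
  rewrite hornerq => /qE Uroot; apply/eqP/negP => /negP p0.
  have [N HN] := injective_seq_roots inj p0.
  have UN : U [set k | (N <= k)%N] by apply: oU; exists N.
  have [k /= [Nk rk]] := filter_ex (filterI UN Uroot).
  by have := HN k Nk; rewrite /= rk eqxx.
have [A [D [hD Ak AT AX DT]]] :=
  derivation_of_transcendental [seq X z | z <- enum Y] dom char0 tr.
have {}AX z : A (X z) by apply: AX; apply/mapP; exists z; rewrite ?mem_enum.
have [hA DD DM] := hD.
have qsum (I : finType) (G : I -> nat -> R) :
    q (fun k => \sum_i G i k) = \sum_i q (G i).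
  by rewrite -rmorph_sum; congr (q _); apply/funext => k; rewrite fct_sumE.
have qprod (I : finType) (P : pred I) (G : I -> nat -> R) :
    q (fun k => \prod_(i | P i) G i k) = \prod_(i | P i) q (G i).
  by rewrite -rmorph_prod; congr (q _); apply/funext => k; rewrite fct_prodE.
have qM (f g : nat -> R) : q (fun k => f k * g k) = q f * q g by rewrite -rmorphM.
have TE : T = \sum_y iota (v y) * \prod_j X (y j).
  rewrite /T /comp /common_value qsum; apply: eq_bigr => y _.
  by rewrite qM qprod.
have AM (a b : F) : A a -> A b -> A (a * b) by case: hA => _ _; apply.
(* Product rule: the payoffs are constants for [D], and the terms in which the [i]-th factor is
   differentiated are grouped by the action [z] of player [i]. *)
have DTE : D T = \sum_i \sum_z D (X z) * q (fun k => deviation_value v i z (xs k)).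
  rewrite TE (derivation_sum hD); last first.
    move=> y _; apply: AM; first by have [] := Ak (v y).
    by apply: is_subring_prod.
  transitivity (\sum_(y : {ffun 'I_n -> Y}) \sum_i
      iota (v y) * (D (X (y i)) * \prod_(j | j != i) X (y j))).
    apply: eq_bigr => y _; have [Av Dv] := Ak (v y).
    rewrite DM ?Dv ?mul0r ?add0r //; last by apply: is_subring_prod.
    by rewrite (derivation_prod hD) // big_distrr.
  rewrite exchange_big /=; apply: eq_bigr => i _.
  transitivity (\sum_(y : {ffun 'I_n -> Y}) \sum_z
      D (X z) * q (fun k => v y * ((y i == z)%:R * \prod_(j | j != i) xs k (y j)))).
    apply: eq_bigr => y _; rewrite [RHS](bigD1 (y i)) //= eqxx [Z in _ = _ + Z]big1 ?addr0.
      rewrite !qM qprod (_ : q (fun=> true%:R) = 1) ?mul1r; last exact: rmorph1.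
      exact: mulrCA.
    move=> z /negbTE zy; rewrite eq_sym zy !qM.
    by rewrite (_ : q (fun=> false%:R) = 0) ?mul0r ?mulr0 //; exact: rmorph0.
  rewrite exchange_big /=; apply: eq_bigr => z _.
  by rewrite -big_distrr /= -qsum.
move: DT; rewrite DTE; apply/negP; rewrite negbK; apply/eqP; apply: big1 => i _.
pose lam k := projT1 (cid ((st k).2 i)).
have lamE k z : xs k z * (lam k - deviation_value v i z (xs k)) = 0.
  by rewrite /lam; case: cid.
(* In a ring without zero divisors, either [X z] is 0 and so is its derivative, or the deviation
   value equals the multiplier. The multiplier then factors out and leaves the derivative of the sum
   of the [X z], that is of 1. *)
transitivity (\sum_z D (X z) * q lam).
  apply: eq_bigr => z _.
  have : X z * (q lam - q (fun k => deviation_value v i z (xs k))) = 0.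
    rewrite -rmorphB -rmorphM -(rmorph0 q); congr (q _).
    by apply/funext => k; exact: lamE.
  case/dom => [->|/eqP]; first by rewrite (derivation0 hD) !mul0r.
  by rewrite subr_eq0 => /eqP ->.
rewrite -big_distrl /= -(derivation_sum hD) //.
rewrite (_ : \sum_z X z = 1) ?(derivation1 hD) ?mul0r //.
rewrite /X -qsum -(rmorph1 q); congr (q _); apply/funext => k.
by have [] := st k.
Qed.

Lemma stationary_values_finite v : finite_set [set common_value v x | x in stationary v].
Proof.
apply: contrapT => /infiniteP/pcard_leP/injfunPex[g gS ginj].
have st k : exists x, stationary v x /\ common_value v x = g k.
  by have [x sx xE] := gS k I; exists x.
pose xs k := projT1 (cid (st k)).
have xsP k : stationary v (xs k) /\ common_value v (xs k) = g k.
  by rewrite /xs; case: cid.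
apply: (@stationary_values_not_injective v xs) => [k|k l]; first by have [] := xsP k.
by rewrite /= (xsP k).2 (xsP l).2; apply: ginj; rewrite inE.
Qed.
End Values.

(** * Perturbed ascent *)

Section RealSequences.
Context {R : realType}.

Lemma cvg0_lt (f : nat -> R) (e : R) : f t @[t --> \oo] --> 0 -> 0 < e ->
  exists N, forall t, (N <= t)%N -> `|f t| < e.
Proof.
move=> /cvgr0Pnorm_lt /(_ e) h e0; have [N _ HN] := h e0.
by exists N => t Nt; exact: HN.
Qed.

Lemma cvg0_of_lt (f : nat -> R) :
  (forall e, 0 < e -> exists N, forall t, (N <= t)%N -> `|f t| < e) ->
  f t @[t --> \oo] --> 0.
Proof.
move=> h; apply/cvgr0Pnorm_lt => e e0; have [N HN] := h e e0.
by exists N => // t /= Nt; exact: HN.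
Qed.

Lemma cvg_sum_seq (I : Type) (r : seq I) (f : I -> nat -> R) (l : I -> R) :
  (forall i, f i t @[t --> \oo] --> l i) ->
  \sum_(i <- r) f i t @[t --> \oo] --> \sum_(i <- r) l i.
Proof.
move=> fl; elim: r => [|i r IH].
  rewrite big_nil; under eq_fun do rewrite big_nil; exact: cvg_cst.
rewrite big_cons; under eq_fun do rewrite big_cons; exact: cvgD.
Qed.

Lemma interval_avoiding_seq (s : seq R) (c d : R) : c < d ->
  exists a b, [/\ c <= a, a < b, b <= d & forall w, w \in s -> w < a \/ b < w].
Proof.
elim: s c d => [|w s IH] c d cd.
  by exists c, d; split.
have [wc|wc] := ltP w (c + (d - c) / 2).
  have [|a [b [h1 h2 h3 h4]]] := IH (c + (d - c) / 2) d; first by lra.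
  exists a, b; split => //; first by lra.
  move=> w'; rewrite inE => /orP[/eqP ->|]; [left; lra|exact: h4].
(* Here [w] lies at or above the midpoint; stopping at one third rather than one half makes the
   interval end strictly below [w]. *)
have [|a [b [h1 h2 h3 h4]]] := IH c (c + (d - c) / 3); first by lra.
exists a, b; split => //; first by lra.
move=> w'; rewrite inE => /orP[/eqP ->|]; [right; lra|exact: h4].
Qed.

(* The values of a perturbed ascent process cannot cross downwards an interval
   without critical value; since there are finitely many critical values the
   values converge, and so [G] cannot stay away from 0. *)
Lemma perturbed_ascent (v G gam eps : nat -> R) (W : set R) (B C : R) :
  (forall t, 0 <= gam t) -> gam t @[t --> \oo] --> 0 -> eps t @[t --> \oo] --> 0 ->
  (forall N, exists M, 1 / 2 <= \sum_(N <= k < M) gam k) ->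
  (\forall t \near \oo, v t + gam t * (G t - eps t) <= v t.+1) ->
  (forall t, `|v t.+1 - v t| <= C * gam t) ->
  (forall t, `|G t.+1 - G t| <= C * gam t) ->
  (forall t, `|v t| <= B) -> (forall t, 0 <= G t) -> finite_set W ->
  (forall delta, 0 < delta -> exists2 kappa, 0 < kappa &
     forall t, G t < kappa -> exists2 w, W w & `|v t - w| < delta) ->
  G t @[t --> \oo] --> 0.
Proof.
move=> gam0 gamC epsC div [N0 _ incr] lipv lipG Bv G0 Wfin sep.
wlog C0 : C lipv lipG / 0 < C.
  move=> H; apply: (H (`|C| + 1)).
  - move=> t; apply: (le_trans (lipv t)); apply: ler_wpM2r => //.
    by rewrite (le_trans (ler_norm C)) // lerDl.
  - move=> t; apply: (le_trans (lipG t)); apply: ler_wpM2r => //.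
    by rewrite (le_trans (ler_norm C)) // lerDl.
  - by rewrite ltr_wpDl.
(* A level [d] that is reached again and again cannot be left for values below [c < d]. *)
have barrier c d : c < d -> (forall N, exists2 t, (N <= t)%N & d <= v t) ->
    exists N, forall t, (N <= t)%N -> c <= v t.
  move=> cd freq.
  have [s Ws] : exists s : seq R, W = [set` s] by apply/finite_seqP.
  have [a0 [b0 [ca0 ab0 b0d avoid]]] := interval_avoiding_seq s cd.
  (* The critical-free interval is cut in three. In the middle third [v] stays [del] away from all
     critical values, so [G >= kap] and [v] cannot decrease; from above [b] one late step moves [v]
     by less than [del = b - a] and cannot jump below [a]. *)
  pose del := (b0 - a0) / 3.
  have del0 : 0 < del by rewrite /del; lra.
  pose a := a0 + del; pose b := b0 - del.
  have ab : b - a = del by rewrite /a /b /del; lra.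
  have [kap kap0 Hk] := sep del del0.
  have [N1 H1] := cvg0_lt epsC kap0.
  have [N2 H2] : exists N, forall t, (N <= t)%N -> `|gam t| < del / C.
    by apply: cvg0_lt gamC _; rewrite divr_gt0.
  have [t0 Nt0 vt0] := freq (maxn N0 (maxn N1 N2)).
  exists t0 => t t0t.
  suff : a <= v t by rewrite /a; lra.
  rewrite -(subnKC t0t); elim: (t - t0)%N => [|m IH].
    by rewrite addn0; move: vt0; rewrite /a /del; lra.
  rewrite addnS; set k := (t0 + m)%N in IH *.
  have t0k : (t0 <= k)%N by rewrite leq_addr.
  move: (leq_trans Nt0 t0k); rewrite !geq_max => /and3P[k0 k1 k2].
  have [vb|vb] := leP (v k) b.
    have Gk : kap <= G k.
      rewrite leNgt; apply/negP => /Hk[w]; rewrite Ws /= => /avoid.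
      rewrite ltr_norml => -[] hw /andP[h1 h2].
        by move: IH h1 h2 hw; rewrite /a; lra.
      by move: vb h1 h2 hw; rewrite /b; lra.
    have := H1 k k1; rewrite ltr_norml => /andP[_ ek].
    apply: le_trans IH _; apply: le_trans (incr k k0).
    by rewrite lerDl mulr_ge0 // subr_ge0 (le_trans (ltW ek)).
  have gk : C * gam k < del.
    by have := H2 k k2; rewrite ger0_norm // ltr_pdivlMr // mulrC.
  have := lipv k; rewrite ler_norml => /andP[h _].
  by move: h gk vb ab; lra.
(* [sup S] is the limit superior of [v], and [barrier] makes it the limit. *)
pose S := [set x | forall N, exists2 t, (N <= t)%N & x <= v t].
have S0 : S !=set0.
  exists (- B) => N; exists N => //.
  by have := Bv N; rewrite ler_norml => /andP[].
have Sub : has_ubound S.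
  exists B => x /(_ 0%N)[t _] /le_trans; apply.
  by have := Bv t; rewrite ler_norml => /andP[].
pose L := sup S.
have vcvg theta : 0 < theta ->
    exists N, forall t, (N <= t)%N -> `|v t - L| < theta.
  move=> th0.
  have [N1 H1] : exists N, forall t, (N <= t)%N -> v t < L + theta.
    apply: contrapT => H.
    have : S (L + theta).
      move=> N; apply: contrapT => H1; apply: H; exists N => t Nt.
      by rewrite ltNge; apply/negP => h; apply: H1; exists t.
    by move=> /(ub_le_sup Sub); rewrite -/L; lra.
  have th4 : 0 < theta / 4 by lra.
  have [x Sx Lx] := sup_adherent th4 (conj S0 Sub).
  have [N2 H2] : exists N, forall t, (N <= t)%N -> L - theta / 2 <= v t.
    by apply: barrier Sx; rewrite -/L in Lx; lra.
  exists (maxn N1 N2) => t; rewrite geq_max => /andP[/H1 h1 /H2 h2].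
  by rewrite ltr_norml; apply/andP; split; lra.
apply: cvg0_of_lt => kap kap0.
(* From a late [t] with [G t >= kap], the Lipschitz bound keeps [G >= kap / 2] until the steps add
   up to [h], so [v] rises by at least [h * kap / 4] over that window. This contradicts that both
   ends are within [h * kap / 8] of the limit. The bound 1 / 2 ensures that such a window exists. *)
pose h := Num.min (1 / 2) (kap / (2 * C)).
have h0 : 0 < h by rewrite lt_min; apply/andP; split; [lra|rewrite divr_gt0 // mulr_gt0].
have Ch : C * h <= kap / 2.
  apply: (@le_trans _ _ (C * (kap / (2 * C)))).
    by rewrite ler_pM2l // ge_min lexx orbT.
  suff -> : C * (kap / (2 * C)) = kap / 2 by [].
  by field; lra.
have hk : 0 < h * kap / 8 by rewrite divr_gt0 // mulr_gt0.
have [N1 H1] := vcvg _ hk.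
have kap4 : 0 < kap / 4 by lra.
have [N2 H2] := cvg0_lt epsC kap4.
exists (maxn N0 (maxn N1 N2)) => t; rewrite !geq_max => /and3P[t0 t1 t2].
rewrite ger0_norm // ltNge; apply/negP => Gt.
have exM : exists M, h <= \sum_(t <= k < M) gam k.
  have [M HM] := div t; exists M; apply: le_trans HM.
  by rewrite ge_min lexx.
case: (ex_minnP exM) => M hM minM.
have tM : (t <= M)%N.
  rewrite leqNgt; apply/negP => /ltnW Mt; move: hM; rewrite big_geq //.
  by rewrite leNgt h0.
have small s : (t <= s < M)%N -> \sum_(t <= k < s) gam k < h.
  move=> /andP[ts sM]; rewrite ltNge; apply/negP => /minM.
  by rewrite leqNgt sM.
have Gs s : (t <= s)%N -> `|G s - G t| <= C * \sum_(t <= k < s) gam k.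
  move=> ts; rewrite -(subnKC ts); elim: (s - t)%N => [|m IH].
    by rewrite addn0 subrr normr0 big_geq // mulr0.
  rewrite addnS big_nat_recr ?leq_addr //= mulrDr.
  rewrite -(subrK (G (t + m)%N) (G _.+1)) -addrA addrC.
  by rewrite (le_trans (ler_normD _ _)) // lerD.
have vs s : (t <= s <= M)%N -> v t + (kap / 4) * \sum_(t <= k < s) gam k <= v s.
  move=> /andP[ts]; rewrite -(subnKC ts); elim: (s - t)%N => [|m IH] sM.
    by rewrite addn0 big_geq // mulr0 addr0.
  rewrite addnS in sM *; set k := (t + m)%N in IH sM *.
  have tk : (t <= k)%N by rewrite leq_addr.
  rewrite big_nat_recr //= mulrDr addrA.
  apply: le_trans (incr k (leq_trans t0 tk)).
  apply: lerD; first by apply: IH; exact: ltnW.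
  have Gk : kap / 2 <= G k.
    have := Gs k tk; rewrite ler_norml => /andP[h1 _].
    have : C * \sum_(t <= k < k) gam k <= C * h.
      by rewrite ler_pM2l // ltW // small // tk.
    move: Ch Gt h1; lra.
  have := H2 k (leq_trans t2 tk); rewrite ltr_norml => /andP[_ h2].
  by rewrite mulrC ler_wpM2l //; lra.
have := vs M; rewrite tM leqnn => /(_ isT) hv.
have h1 := H1 t t1; have h2 := H1 M (leq_trans t1 tM).
rewrite !ltr_norml in h1 h2.
move/andP: h1 => [h11 h12]; move/andP: h2 => [h21 h22].
have : kap / 4 * h <= kap / 4 * \sum_(t <= k < M) gam k by rewrite ler_pM2l.
by move: hv h11 h12 h21 h22; lra.
Qed.
End RealSequences.

(** * Compactness of the cube *)

Section Cube.
Context {R : realType} {I : finType}.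
Implicit Types p q : I -> R.

Definition cube : set (I -> R) := [set p | forall i, 0 <= p i <= 1].

Definition dist1 p q : R := \sum_i `|p i - q i|.

Lemma dist1_ge0 p q : 0 <= dist1 p q.
Proof. by apply: sumr_ge0 => i _. Qed.

Lemma le_dist1 p q i : `|p i - q i| <= dist1 p q.
Proof. by rewrite /dist1 (bigD1 i) //= lerDl sumr_ge0. Qed.

Definition lipschitz1 (C : R) (Phi : (I -> R) -> R) : Prop :=
  forall p q, cube p -> cube q -> `|Phi p - Phi q| <= C * dist1 p q.

(** Otherwise points with [Phi] below 1 / (k + 1) would all stay [delta] away from the zeros; by
    compactness of the cube they have a cluster point, which is a zero by continuity. *)
Lemma near_zero_set (Phi : (I -> R) -> R) (C delta : R) :
  lipschitz1 C Phi -> (forall p, cube p -> 0 <= Phi p) -> 0 < delta ->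
  exists2 kappa, 0 < kappa & forall p, cube p -> Phi p < kappa ->
    exists q, [/\ cube q, Phi q = 0 & dist1 p q < delta].
Proof.
move=> lip Phi0 delta0; apply: contrapT => H.
have bad (k : nat) : exists p, [/\ cube p, Phi p < k.+1%:R^-1 &
    forall q, cube q -> Phi q = 0 -> delta <= dist1 p q].
  apply: contrapT => H1; apply: H; exists k.+1%:R^-1; first by rewrite invr_gt0.
  move=> p cp Pp; apply: contrapT => H2; apply: H1; exists p; split => // q cq Pq.
  by rewrite leNgt; apply/negP => h; apply: H2; exists q.
pose p k : prod_topology (fun _ : I => R) := projT1 (cid (bad k)).
have pP k : [/\ cube (p k), Phi (p k) < k.+1%:R^-1 &
    forall q, cube q -> Phi q = 0 -> delta <= dist1 (p k) q].
  by rewrite /p; case: cid.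
have comp : compact [set f : prod_topology (fun _ : I => R) |
    forall i, `[0, 1]%classic (f i)].
  exact: (@tychonoff I (fun=> R) (fun=> `[0, 1]%classic)
    (fun=> @segment_compact R 0 1)).
have [|q [cq clq]] := comp (p k @[k --> \oo]) _.
  by exists 0%N => // k _ i /=; rewrite in_itv /=; have [h _ _] := pP k; exact: h.
have {}cq : cube q by move=> i; have := cq i; rewrite /= in_itv.
have close (e : R) (N : nat) : 0 < e ->
    exists k, (N <= k)%N /\ dist1 (p k) q < e.
  move=> e0.
  (* The successor makes the sum of the [#|I|] coordinate errors strictly less than [e] and keeps
     the denominator nonzero when [I] is empty. *)
  pose e' := e / (#|I|.+1)%:R.
  have e'0 : 0 < e' by rewrite divr_gt0.
  have nq : nbhs q [set f | forall i, `|f i - q i| < e'].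
    apply: (@filter_forall _ I (fun i f => `|f i - q i| < e') (nbhs q)) => i.
    have : \forall y \near (q i : R), `|y - q i| < e'.
      by apply: (@cvgr_distC_lt _ _ _ (nbhs (q i : R)) _ id) => //; exact: cvg_id.
    exact: (@proj_continuous I (fun=> R) i q).
  have /(_ [set f | exists k, (N <= k)%N /\ f = p k] _ _ nq) := clq.
  case; first by exists N => // k /= Nk; exists k.
  move=> f [[k [Nk ->]] /= hk]; exists k; split => //.
  apply: (@le_lt_trans _ _ (\sum_(i : I) e')).
    by apply: ler_sum => i _; exact: ltW.
  rewrite sumr_const -[X in X < _]mulr_natr /e' mulrAC ltr_pdivrMr ?ltr0n //.
  by rewrite ltr_pM2l // ltr_nat.
have C1 : 0 < `|C| + 1 by rewrite ltr_wpDl.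
have Phiq : Phi q = 0.
  apply/eqP; rewrite eq_le Phi0 // andbT; apply/ler_addgt0Pl => e e0.
  rewrite addr0.
  have [N HN] : exists N : nat, N.+1%:R^-1 < e / 2.
    have e2 : 0 < e / 2 by lra.
    have [N _ h] := near_infty_natSinv_lt (PosNum e2).
    by exists N; apply: h => /=.
  have [k [Nk dk]] := @close (e / 2 / (`|C| + 1)) N ltac:(by rewrite !divr_gt0).
  have [cp Pp _] := pP k.
  have Pk : Phi (p k) < e / 2.
    apply: lt_trans Pp _; apply: le_lt_trans HN.
    by rewrite lef_pV2 ?posrE ?ltr0n // ler_nat.
  have := lip _ _ cp cq; rewrite ler_norml => /andP[h _].
  have : C * dist1 (p k) q <= e / 2.
    apply: (@le_trans _ _ ((`|C| + 1) * dist1 (p k) q)).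
      rewrite ler_wpM2r ?dist1_ge0 // (le_trans (ler_norm _)) // lerDl //.
    by rewrite mulrC -ler_pdivlMr // ltW.
  by move: h Pk; lra.
have [k [_ dk]] := close delta 0%N delta0.
have [_ _ h] := pP k.
by have := h q cq Phiq; rewrite leNgt dk.
Qed.

End Cube.

(** * Values and gaps *)

Section Products.
Context {R : realType} {J : Type}.
Implicit Types (a b : J -> R) (r : seq J) (P : pred J).

Lemma prod_unit r P a : (forall j, 0 <= a j <= 1) -> 0 <= \prod_(j <- r | P j) a j <= 1.
Proof.
move=> h; elim/big_rec: _ => [|j x _ /andP[x0 x1]]; first by rewrite ler01 lexx.
by have /andP[a0 a1] := h j; rewrite mulr_ge0 //= mulr_ile1.
Qed.

(** The factors are exchanged one at a time, all the others being at most 1. *)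
Lemma prod_dist r P a b : (forall j, 0 <= a j <= 1) -> (forall j, 0 <= b j <= 1) ->
  `|\prod_(j <- r | P j) a j - \prod_(j <- r | P j) b j| <=
    \sum_(j <- r | P j) `|a j - b j|.
Proof.
move=> ha hb; elim: r => [|k r IH]; first by rewrite !big_nil subrr normr0.
rewrite !big_cons; case: ifP => // Pk.
set A := \prod_(j <- r | P j) a j in IH *; set B := \prod_(j <- r | P j) b j in IH *.
have -> : a k * A - b k * B = (a k - b k) * A + b k * (A - B) by ring.
apply: le_trans (ler_normD _ _) _; rewrite !normrM.
have /andP[A0 A1] := prod_unit r P ha; have /andP[b0 b1] := hb k.
apply: lerD; first by rewrite ler_piMr // ger0_norm.
by apply: le_trans IH; rewrite ler_piMl // ger0_norm.
Qed.
End Products.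

(** A new factor [k] adds to the old remainder the cross term (b_k - a_k)(B - A), a product of two
    first order quantities that the expansion of the square absorbs. *)
Lemma prod_taylor (R : realType) (J : eqType) (r : seq J) (a b : J -> R) : uniq r ->
  (forall j, 0 <= a j <= 1) -> (forall j, 0 <= b j <= 1) ->
  `|\prod_(j <- r) b j - \prod_(j <- r) a j -
     \sum_(i <- r) (b i - a i) * \prod_(j <- r | j != i) a j| <=
    (\sum_(j <- r) `|b j - a j|) ^+ 2.
Proof.
move=> + ha hb; elim: r => [|k r IH] /=.
  by rewrite !big_nil !subrr normr0 expr0n.
case/andP=> kr ur; move: (IH ur) => {IH}.
rewrite !big_cons eqxx /=.
have -> : \prod_(j <- r | j != k) a j = \prod_(j <- r) a j.
  rewrite big_seq_cond [RHS]big_seq_cond; apply: eq_bigl => j.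
  case jr: (j \in r) => //=; apply: contraNneq kr => jk.
  by rewrite -jk jr.
have -> : \sum_(i <- r) (b i - a i) * \prod_(j <- k :: r | j != i) a j =
    a k * \sum_(i <- r) (b i - a i) * \prod_(j <- r | j != i) a j.
  rewrite big_distrr /= big_seq [RHS]big_seq; apply: eq_bigr => j jr.
  rewrite big_cons ifT; first by rewrite mulrCA.
  by apply: contraNneq kr => kj; rewrite kj.
have := @prod_dist _ _ r xpredT b a hb ha.
set A := \prod_(j <- r) a j; set B := \prod_(j <- r) b j.
set T := \sum_(j <- r) `|_|; set S := \sum_(i <- r) _ => BA H.
have -> : b k * B - a k * A - ((b k - a k) * A + a k * S) =
  a k * (B - A - S) + (b k - a k) * (B - A) by ring.
apply: le_trans (ler_normD _ _) _; rewrite !normrM.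
have /andP[a0 a1] := ha k.
have T0 : 0 <= T by apply: sumr_ge0.
have h1 : `|a k| * `|B - A - S| <= T ^+ 2.
  by apply: le_trans H; rewrite ler_piMl // ger0_norm.
have h2 : `|b k - a k| * `|B - A| <= `|b k - a k| * T by rewrite ler_wpM2l.
have h3 : 0 <= `|b k - a k| * T by rewrite mulr_ge0.
have h4 : 0 <= `|b k - a k| ^+ 2 by rewrite exprn_ge0.
rewrite sqrrD -mulr_natr; lra.
Qed.

Section Values.
Context {R : realType} {n : nat} {Y : finType}.
Implicit Types (v : {ffun 'I_n -> Y} -> R) (x c : Y -> R) (i j : 'I_n) (z : Y).

Definition total_weight v : R := \sum_y `|v y|.

Lemma total_weight_ge0 v : 0 <= total_weight v.
Proof. exact: sumr_ge0. Qed.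

Lemma weighted_sum_le v (g : {ffun 'I_n -> Y} -> R) (K : R) :
  (forall y, `|g y| <= K) -> `|\sum_y v y * g y| <= total_weight v * K.
Proof.
move=> h; apply: le_trans (ler_norm_sum _ _ _) _; rewrite /total_weight mulr_suml.
by apply: ler_sum => y _; rewrite normrM ler_wpM2l.
Qed.

Lemma sum_coords_dist1 x x' (y : 'I_n -> Y) (P : pred 'I_n) :
  \sum_(j | P j) `|x (y j) - x' (y j)| <= n%:R * dist1 x x'.
Proof.
apply: (@le_trans _ _ (\sum_(j < n) dist1 x x')).
  rewrite big_mkcond; apply: ler_sum => j _; case: ifP => _; first exact: le_dist1.
  exact: dist1_ge0.
by rewrite sumr_const card_ord mulr_natl.
Qed.

Lemma common_value_lipschitz v : lipschitz1 (total_weight v * n%:R) (common_value v).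
Proof.
move=> x x' hx hx'; rewrite /common_value -sumrB.
under eq_bigr do rewrite -mulrBr.
rewrite -mulrA; apply: weighted_sum_le => y.
apply: le_trans (prod_dist _ _ (fun j => hx _) (fun j => hx' _)) _.
exact: sum_coords_dist1.
Qed.

Lemma deviation_value_lipschitz v i z :
  lipschitz1 (total_weight v * n%:R) (deviation_value v i z).
Proof.
move=> x x' hx hx'; rewrite /deviation_value -sumrB.
under eq_bigr do rewrite -mulrBr.
rewrite -mulrA; apply: weighted_sum_le => y.
rewrite -mulrBr normrM normr_nat.
apply: (@le_trans _ _ (\sum_(j | j != i) `|x (y j) - x' (y j)|)).
  apply: le_trans (prod_dist _ _ (fun j => hx _) (fun j => hx' _)).
  by case: (_ == _); rewrite ?mul1r ?mul0r.
exact: sum_coords_dist1.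
Qed.

Lemma common_value_bound v x : cube x -> `|common_value v x| <= total_weight v.
Proof.
move=> hx; rewrite -[leRHS]mulr1; apply: weighted_sum_le => y.
by have /andP[h0 h1] := prod_unit (index_enum 'I_n) xpredT (fun j => hx (y j));
  rewrite ger0_norm.
Qed.

Lemma deviation_value_bound v i z x : cube x -> `|deviation_value v i z x| <= total_weight v.
Proof.
move=> hx; rewrite -[leRHS]mulr1; apply: weighted_sum_le => y.
have /andP[h0 h1] := prod_unit (index_enum 'I_n) (fun j => j != i) (fun j => hx (y j)).
by rewrite normrM normr_nat (ger0_norm h0); case: (_ == _); rewrite ?mul1r ?mul0r.
Qed.

Lemma sum_deviation_value v i c x :
  \sum_z c z * deviation_value v i z x =
  \sum_(y : {ffun 'I_n -> Y}) v y * (c (y i) * \prod_(j | j != i) x (y j)).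
Proof.
under eq_bigr do rewrite big_distrr /=.
rewrite exchange_big /=; apply: eq_bigr => y _.
rewrite (bigD1 (y i)) //= eqxx [X in _ + X]big1 ?addr0.
  by rewrite mul1r mulrCA.
by move=> z /negbTE zy; rewrite eq_sym zy mul0r !mulr0.
Qed.

Lemma common_value_taylor v x x' : cube x -> cube x' ->
  `|common_value v x' - common_value v x -
    \sum_i \sum_z (x' z - x z) * deviation_value v i z x| <=
  total_weight v * (n%:R * dist1 x' x) ^+ 2.
Proof.
move=> hx hx'; under eq_bigr do rewrite (sum_deviation_value v _ (fun z => x' z - x z)).
rewrite exchange_big /= /common_value -!sumrB.
rewrite (eq_bigr (fun y : {ffun 'I_n -> Y} => v y * (\prod_j x' (y j) - \prod_j x (y j) -
   \sum_i (x' (y i) - x (y i)) * \prod_(j | j != i) x (y j)))); last first.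
  by move=> y _; rewrite !mulrBr big_distrr.
apply: weighted_sum_le => y.
apply: le_trans (prod_taylor (index_enum_uniq 'I_n) (fun j => hx _) (fun j => hx' _)) _.
rewrite ler_pXn2r ?nnegrE ?sum_coords_dist1 ?sumr_ge0 //.
by rewrite mulr_ge0 // dist1_ge0.
Qed.
End Values.

Section Gap.
Context {R : realType} {Y : finType} (z0 : Y) (W : Y -> (Y -> R) -> R).
Context (K : R) (Wlip : forall z, lipschitz1 K (W z)).
Context (B : R) (Wbound : forall z x, cube x -> `|W z x| <= B).
Implicit Types (x c : Y -> R).

(** The seed [W z0 x] is itself one of the terms, so this is exactly the maximum over the
    actions. *)
Definition best_value x : R := \big[Num.max/W z0 x]_z W z x.

Lemma le_best_value z x : W z x <= best_value x.
Proof. exact: (@le_bigmax _ _ _ (W z0 x) (fun z => W z x)). Qed.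

Lemma best_value_le x (a : R) : (forall z, W z x <= a) -> best_value x <= a.
Proof. by move=> h; apply: bigmax_le. Qed.

Lemma best_value_lipschitz : lipschitz1 K best_value.
Proof.
move=> x x' hx hx'.
have h1 : best_value x' <= best_value x + K * dist1 x x'.
  apply: best_value_le => z.
  have := Wlip z hx hx'; rewrite ler_norml => /andP[h _].
  by have := le_best_value z x; move: h; lra.
have h2 : best_value x <= best_value x' + K * dist1 x x'.
  apply: best_value_le => z.
  have := Wlip z hx hx'; rewrite ler_norml => /andP[_ h].
  by have := le_best_value z x'; move: h; lra.
by rewrite ler_norml; apply/andP; split; lra.
Qed.

Lemma best_value_bound x : cube x -> `|best_value x| <= B.
Proof.
move=> hx; rewrite ler_norml; apply/andP; split.
  have := Wbound z0 hx; rewrite ler_norml => /andP[h _].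
  exact: le_trans h (le_best_value z0 x).
apply: best_value_le => z.
by have := Wbound z hx; rewrite ler_norml => /andP[_ h].
Qed.

(** The regret of the reply [c] to [x]. As a sum of nonnegative terms weighted by [c] it is monotone
    in [c], and its vanishing is complementary slackness, action by action. *)
Definition gap c x : R := \sum_z c z * (best_value x - W z x).

Lemma gap_ge0 c x : (forall z, 0 <= c z) -> 0 <= gap c x.
Proof. by move=> c0; apply: sumr_ge0 => z _; rewrite mulr_ge0 ?subr_ge0 ?le_best_value. Qed.

Lemma gap_eq0 c x : (forall z, 0 <= c z) -> gap c x = 0 ->
  forall z, c z * (best_value x - W z x) = 0.
Proof.
move=> c0 /eqP; rewrite psumr_eq0 => [/allP h z|z _].
  by apply/eqP; apply: h; rewrite mem_index_enum.
by rewrite mulr_ge0 ?subr_ge0 ?le_best_value.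
Qed.

Lemma gap_monotone c c' x (a : R) : (forall z, c z <= a * c' z) -> gap c x <= a * gap c' x.
Proof.
move=> h; rewrite /gap big_distrr /=; apply: ler_sum => z _; rewrite mulrA.
by rewrite ler_wpM2r // subr_ge0 le_best_value.
Qed.

Lemma gap_lipschitz c c' x x' : cube c -> cube c' -> cube x -> cube x' ->
  `|gap c x - gap c' x'| <=
    2 * B * dist1 c c' + 2 * K * #|Y|%:R * dist1 x x'.
Proof.
move=> hc hc' hx hx'; rewrite /gap -sumrB.
apply: le_trans (ler_norm_sum _ _ _) _.
rewrite [X in _ <= X + _]mulr_sumr.
have -> : 2 * K * #|Y|%:R * dist1 x x' = \sum_(z : Y) 2 * K * dist1 x x'.
  by rewrite sumr_const -mulr_natr; ring.
rewrite -big_split /=; apply: ler_sum => z _.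
have -> : c z * (best_value x - W z x) - c' z * (best_value x' - W z x') =
  (c z - c' z) * (best_value x - W z x) +
  c' z * ((best_value x - best_value x') - (W z x - W z x')) by ring.
apply: le_trans (ler_normD _ _) _; rewrite !normrM.
have /andP[c0 c1] := hc' z.
apply: lerD.
  rewrite mulrC ler_wpM2r //.
  apply: le_trans (ler_normB _ _) _.
  by have := best_value_bound hx; have := Wbound z hx; lra.
apply: (@le_trans _ _ `|best_value x - best_value x' - (W z x - W z x')|).
  by rewrite ler_piMl // ger0_norm.
apply: le_trans (ler_normB _ _) _.
by have := best_value_lipschitz hx hx'; have := Wlip z hx hx'; lra.
Qed.

Lemma sum_gap c x : \sum_z c z = 1 -> gap c x = best_value x - \sum_z c z * W z x.
Proof.
move=> c1; rewrite /gap; under eq_bigr do rewrite mulrBr.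
by rewrite sumrB -mulr_suml c1 mul1r.
Qed.
End Gap.

Lemma simplex_cube (R : realType) (Y : finType) (x : Y -> R) : simplex x -> cube x.
Proof.
move=> [x0 x1] z; rewrite x0 /= -x1 (bigD1 z) //= lerDl; exact: sumr_ge0.
Qed.

Lemma simplex_dist1 (R : realType) (Y : finType) (x c : Y -> R) :
  simplex x -> simplex c -> dist1 x c <= 2.
Proof.
move=> [x0 x1] [c0 c1]; apply: (@le_trans _ _ (\sum_z (x z + c z))).
  apply: ler_sum => z _; apply: le_trans (ler_normB _ _) _.
  by rewrite !ger0_norm.
by rewrite big_split /= x1 c1.
Qed.

(** * Best-response processes *)

Section BestResponseProcess.
Context {R : realType} {n : nat} {Y : finType} (v : {ffun 'I_n -> Y} -> R).
Context (i0 : 'I_n) (z0 : Y).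
Context (symmetric : forall i z x, deviation_value v i z x = deviation_value v i0 z x).

Let W z x := deviation_value v i0 z x.
Let K := total_weight v * n%:R.
Let Wlip z : lipschitz1 K (W z). Proof. exact: deviation_value_lipschitz. Qed.
Let Wbound z (x : Y -> R) : cube x -> `|W z x| <= total_weight v.
Proof. exact: deviation_value_bound. Qed.
Let K0 : 0 <= K. Proof. by rewrite mulr_ge0 // total_weight_ge0. Qed.

Definition self_gap x := gap z0 W x x.

Let Cgap := 2 * total_weight v + 2 * K * #|Y|%:R.

Lemma self_gap_lipschitz : lipschitz1 Cgap self_gap.
Proof.
move=> x x' hx hx'; rewrite /Cgap mulrDl.
exact: (gap_lipschitz z0 Wlip Wbound).
Qed.

(** The best value against [x] serves as the multiplier of every player. *)
Lemma self_gap_stationary x : simplex x -> self_gap x = 0 -> stationary v x.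
Proof.
move=> [x0 x1] gx; split => // i; exists (best_value z0 W x) => z.
by rewrite symmetric; exact: (gap_eq0 x0 gx).
Qed.

(** The constraint of total mass 1 is made part of the function, so that the compactness statement
    on the cube locates zeros that lie in the simplex. *)
Definition simplex_gap x := `|\sum_z x z - 1| + self_gap x.

Lemma simplex_gap_lipschitz : lipschitz1 (1 + Cgap) simplex_gap.
Proof.
move=> x x' hx hx'; rewrite /simplex_gap mulrDl mul1r.
have -> (a b c d : R) : a + b - (c + d) = (a - c) + (b - d) by ring.
apply: le_trans (ler_normD _ _) _; apply: lerD; last exact: self_gap_lipschitz.
apply: le_trans (ler_dist_dist _ _) _.
rewrite opprB addrA subrK -sumrB; exact: ler_norm_sum.
Qed.

Lemma simplex_gap_eq0 x : cube x -> simplex_gap x = 0 -> simplex x /\ self_gap x = 0.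
Proof.
move=> hx /eqP; have x0 z : 0 <= x z by have /andP[] := hx z.
rewrite paddr_eq0 ?gap_ge0 // normr_eq0 subr_eq0 => /andP[/eqP x1 /eqP].
by [].
Qed.

Lemma near_equilibrium delta : 0 < delta -> exists2 kappa, 0 < kappa &
  forall x, simplex x -> self_gap x < kappa ->
    exists q, [/\ simplex q, self_gap q = 0 & dist1 x q < delta].
Proof.
move=> d0.
have [|kap kap0 Hk] := near_zero_set simplex_gap_lipschitz _ d0.
  move=> p hp; rewrite addr_ge0 ?gap_ge0 // => z; by have /andP[] := hp z.
exists kap => // x sx gx; have [|q [cq pq dq]] := Hk x (simplex_cube sx).
  by rewrite /simplex_gap sx.2 subrr normr0 add0r.
by have [sq gq] := simplex_gap_eq0 cq pq; exists q.
Qed.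

(** To first order a step raises the potential by n gam (self_gap r - gap c r), and the Taylor
    remainder is of order gam^2. The best-response condition is multiplied by [gam t], hence it says
    nothing at steps of size 0, where the target [c t] is arbitrary. *)
Lemma best_response_process (r c : nat -> Y -> R) (gam eps : nat -> R) :
  (forall t, simplex (r t)) -> (forall t, simplex (c t)) ->
  (forall t z, r t.+1 z = r t z + gam t * (c t z - r t z)) ->
  (forall t, 0 <= gam t) -> gam t @[t --> \oo] --> 0 -> eps t @[t --> \oo] --> 0 ->
  (forall N, exists M, 1 / 2 <= \sum_(N <= k < M) gam k) ->
  (\forall t \near \oo, gam t * gap z0 W (c t) (r t) <= gam t * eps t) ->
  self_gap (r t) @[t --> \oo] --> 0.
Proof.
move=> sr sc rE gam0 gamC epsC div [N0 _ br].
have n0 : 0 < n%:R :> R by rewrite ltr0n (leq_ltn_trans _ (ltn_ord i0)).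
have cr t := simplex_cube (sr t).
have dr t : dist1 (r t.+1) (r t) <= 2 * gam t.
  rewrite /dist1 (eq_bigr (fun z => gam t * `|c t z - r t z|)); last first.
    by move=> z _; rewrite rE addrC addKr normrM ger0_norm.
  by rewrite -mulr_sumr mulrC ler_wpM2r //; exact: (simplex_dist1 (sc t) (sr t)).
pose A := total_weight v * (n%:R * 2) ^+ 2.
have A0 : 0 <= A by rewrite mulr_ge0 ?total_weight_ge0 // exprn_ge0 // mulr_ge0.
(* The factor [n] appears because by symmetry all [n] players contribute equally to the first order
   growth. *)
have ng : n%:R * self_gap (r t) @[t --> \oo] --> 0; last first.
  suff -> : (fun t => self_gap (r t)) = (fun t => n%:R^-1 * (n%:R * self_gap (r t))).
    rewrite -(mulr0 n%:R^-1); apply: cvgM => //; exact: cvg_cst.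
  by apply/funext => t; rewrite mulKf // gt_eqF.
apply: (@perturbed_ascent R (fun t => common_value v (r t))
   (fun t => n%:R * self_gap (r t)) gam (fun t => n%:R * eps t + A * gam t)
   [set common_value v x | x in stationary v] (total_weight v)
   (2 * K + n%:R * Cgap * 2)) => //.
- rewrite -(addr0 0); apply: cvgD.
    by rewrite -(mulr0 n%:R); apply: cvgM => //; exact: cvg_cst.
  by rewrite -(mulr0 A); apply: cvgM => //; exact: cvg_cst.
- exists N0 => // t /= /br {}br.
  have := common_value_taylor v (cr t) (cr t.+1).
  have -> : \sum_i \sum_z (r t.+1 z - r t z) * deviation_value v i z (r t) =
     n%:R * (gam t * (self_gap (r t) - gap z0 W (c t) (r t))).
    under eq_bigr do under eq_bigr do rewrite symmetric rE addrC addKr -mulrA mulrBl.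
    rewrite sumr_const card_ord [RHS]mulr_natl; congr (_ *+ _).
    rewrite -mulr_sumr sumrB; congr (_ * _).
    rewrite /self_gap !sum_gap ?(sr t).2 ?(sc t).2 // /W; ring.
  rewrite ler_norml => /andP[h _].
  have : total_weight v * (n%:R * dist1 (r t.+1) (r t)) ^+ 2 <= A * gam t ^+ 2.
    rewrite /A -mulrA; apply: ler_wpM2l; first exact: total_weight_ge0.
    rewrite -exprMn ler_pXn2r ?nnegrE ?mulr_ge0 ?dist1_ge0 //.
    by rewrite -mulrA ler_wpM2l.
  have : n%:R * (gam t * gap z0 W (c t) (r t)) <= n%:R * (gam t * eps t).
    by rewrite ler_wpM2l.
  move: h; rewrite expr2; lra.
- move=> t; apply: le_trans (common_value_lipschitz v (cr _) (cr _)) _.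
  rewrite -/K; apply: (@le_trans _ _ (K * (2 * gam t))); first by rewrite ler_wpM2l.
  rewrite mulrA (mulrC K) ler_wpM2r // lerDl !mulr_ge0 //.
  by rewrite addr_ge0 ?mulr_ge0 ?total_weight_ge0.
- have C0 : 0 <= Cgap by rewrite addr_ge0 ?mulr_ge0 ?total_weight_ge0.
  move=> t; rewrite -mulrBr normrM (ger0_norm (ltW n0)).
  apply: (@le_trans _ _ (n%:R * (Cgap * (2 * gam t)))).
    rewrite ler_wpM2l ?(ltW n0) //; apply: le_trans (self_gap_lipschitz (cr _) (cr _)) _.
    by rewrite ler_wpM2l.
  have -> : n%:R * (Cgap * (2 * gam t)) = n%:R * Cgap * 2 * gam t by ring.
  by rewrite ler_wpM2r // lerDr mulr_ge0.
- move=> t; exact: common_value_bound.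
- move=> t; rewrite mulr_ge0 ?gap_ge0 ?(ltW n0) //; exact: (sr t).1.
- exact: stationary_values_finite.
- move=> delta d0.
  have K1 : 0 < K + 1 by rewrite ltr_wpDl.
  have [kap kap0 Hk] := near_equilibrium (divr_gt0 d0 K1).
  exists (n%:R * kap); first by rewrite mulr_gt0.
  move=> t; rewrite ltr_pM2l // => /(Hk _ (sr t))[q [sq gq dq]].
  exists (common_value v q).
    by exists q => //; exact: self_gap_stationary.
  apply: le_lt_trans (common_value_lipschitz v (cr t) (simplex_cube sq)) _.
  rewrite -/K; apply: (@le_lt_trans _ _ ((K + 1) * dist1 (r t) q)).
    by rewrite ler_wpM2r ?dist1_ge0 // lerDl.
  by rewrite mulrC -ltr_pdivlMr.
Qed.

End BestResponseProcess.

(** * Payoffs against a common strategy, and their symmetry between players *)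

Lemma mixed_utility_deviate (R : realType) (n : nat) (Y : finType) (u : utilities R n Y)
    (i : 'I_n) (x c : Y -> R) :
  mixed_utility u i (deviate (fun=> c) i x) = \sum_z x z * deviation_value (u i) i z c.
Proof.
rewrite sum_deviation_value; apply: eq_bigr => y _; congr (_ * _).
rewrite (bigD1 i) //= /deviate eqxx; congr (_ * _).
by apply: eq_bigr => j /negbTE ->.
Qed.

Lemma sum_pure (R : realType) (Y : finType) (y : Y) (g : Y -> R) :
  \sum_z pure R y z * g z = g y.
Proof.
rewrite (bigD1 y) //= /pure eqxx mul1r big1 ?addr0 // => z /negbTE ->.
by rewrite mul0r.
Qed.

Lemma simplex_pure (R : realType) (Y : finType) (y : Y) : simplex (pure R y).
Proof.
split=> [z|]; first exact: ler0n.
by rewrite -[RHS](sum_pure y (fun=> 1)); apply: eq_bigr => z _; rewrite mulr1.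
Qed.

(** Exchanging the actions of [i] and [j] in every pure profile preserves the payoff by invariance
    and turns one sum into the other. *)
Lemma deviation_value_symmetric (R : realType) (n : nat) (Y : finType)
    (u : utilities R n Y) (k i j : 'I_n) (z : Y) (x : Y -> R) :
  permutation_invariant u ->
  deviation_value (u k) i z x = deviation_value (u k) j z x.
Proof.
move=> inv; have [->//|ij] := eqVneq i j.
pose h (y : {ffun 'I_n -> Y}) : {ffun 'I_n -> Y} := [ffun l => y (tperm i j l)].
have hK : involutive h by move=> y; apply/ffunP => l; rewrite !ffunE tpermK.
have uh y : u k (h y) = u k y.
  have -> : h y = play2 y i (y j) j (y i).
    apply/ffunP => l; rewrite !ffunE; case: tpermP => [->|->|/eqP/negbTE -> /eqP/negbTE ->//].
      by rewrite eqxx.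
    by rewrite eqxx eq_sym (negbTE ij).
  rewrite inv //; congr (u k _); apply/ffunP => l; rewrite !ffunE.
  by case: eqP => [->//|_]; case: eqP => [->|].
rewrite /deviation_value (reindex h) /=; last by exists h => y _; exact: hK.
apply: eq_bigr => y _; rewrite uh ffunE tpermL; congr (_ * (_ * _)).
rewrite [RHS](reindex (tperm i j)) /=; last by exists (tperm i j) => l _; rewrite tpermK.
apply: eq_big => l; last by rewrite ffunE.
by rewrite -[X in _ = (_ != X)](tpermL i j) (inj_eq perm_inj).
Qed.

Lemma centroid_simplex (R : realType) (n : nat) (Y : finType) (p : profile R n Y) :
  (0 < n)%N -> mixed_profiles p -> simplex (centroid p).
Proof.
move=> n0 hp; split=> [z|].
  by rewrite mulr_ge0 ?invr_ge0 ?ler0n // sumr_ge0 // => i _; exact: (hp i).1.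
rewrite /centroid -mulr_sumr exchange_big /= (eq_bigr (fun=> 1)); last first.
  by move=> i _; exact: (hp i).2.
by rewrite sumr_const card_ord mulVf // pnatr_eq0 -lt0n.
Qed.

(** * A single sample path: pooled frequency and centroid *)

Section Path.
Context {R : realType} {n : nat} {Y : finType} {Omega : Type}.
Context (u : utilities R n Y) (eta : nat -> R) (X : nat -> 'I_n -> Omega -> bool).
Context (a b : nat -> 'I_n -> Omega -> Y) (w : Omega) (i0 : 'I_n) (z0 : Y).
Context (u_identical : identical_utilities u).
Context (u_invariant : permutation_invariant u).
Context (X1 : forall i, X 1 i w = true).
Context (best_response : forall t i, (2 <= t)%N ->
  BR u (eta t) i (centroid_profile (empirical R X a t.-1 w)) (b t.-1 i w)).
Context (deliberate_action : forall t i, (2 <= t)%N -> X t i w = true ->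
  a t i w = b t.-1 i w).
Context (eta_to0 : eta t @[t --> \oo] --> 0).

Let n0 : (0 < n)%N. Proof. exact: leq_ltn_trans (ltn_ord i0). Qed.
Let v := u i0.
Let W z x := deviation_value v i0 z x.
Let l t i := num_deliberate X t i w.
Let q t := empirical R X a t w.

Lemma num_deliberateS t i : l t.+1 i = (l t i + X t.+1 i w)%N.
Proof. by rewrite /l /num_deliberate big_nat_recr. Qed.

Lemma num_deliberate_gt0 t i : (0 < t)%N -> (0 < l t i)%N.
Proof.
case: t => // t _; elim: t => [|t IH]; last by rewrite num_deliberateS addn_gt0 IH.
by rewrite num_deliberateS X1 addn1.
Qed.

Let s t i z : R := \sum_(1 <= k < t.+1 | X k i w) pure R (a k i w) z.

Lemma sum_s t i : \sum_z s t i z = (l t i)%:R.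
Proof.
rewrite /s exchange_big /= /l /num_deliberate natr_sum big_mkcond /=.
apply: eq_bigr => k _; case: (X k i w) => //.
by rewrite (simplex_pure R (a k i w)).2.
Qed.

Lemma empirical_simplex t : (0 < t)%N -> mixed_profiles (q t).
Proof.
move=> t0 i; split=> [z|].
  by rewrite /q /empirical mulr_ge0 ?invr_ge0 ?ler0n // sumr_ge0.
rewrite /q /empirical -mulr_sumr sum_s mulVf // pnatr_eq0 -lt0n.
exact: num_deliberate_gt0.
Qed.

Context (l_ratio : forall i j, (l t i)%:R / (l t j)%:R @[t --> \oo] --> (1 : R)).
Context (l_pinfty : forall (i : 'I_n) (m : nat), exists t, (m <= l t i)%N).

Let Lam t := (\sum_i l t i)%N.
Let active t := (\sum_i X t i w)%N.

Lemma total_deliberateS t : Lam t.+1 = (Lam t + active t.+1)%N.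
Proof.
by rewrite /Lam /active -big_split /=; apply: eq_bigr => i _; exact: num_deliberateS.
Qed.

Lemma total_deliberate_mono : {homo Lam : t1 t2 / (t1 <= t2)%N}.
Proof.
apply: homo_leq => [//|t1 t2 t3|t]; first exact: leq_trans.
by rewrite total_deliberateS leq_addr.
Qed.

Lemma total_deliberate_gt0 t : (0 < t)%N -> (0 < Lam t)%N.
Proof. by move=> t0; rewrite /Lam (bigD1 i0) //= addn_gt0 num_deliberate_gt0. Qed.

Lemma active_le t : (active t <= n)%N.
Proof.
rewrite -[X in (_ <= X)%N]card_ord -sum1_card; apply: leq_sum => i _.
by case: (X t i w).
Qed.

(** Every deliberate action counts once, whoever played it, so that [r] obeys an exact recursion
    with the single step size active / Lam. *)
Let r t z : R := (Lam t)%:R^-1 * \sum_i s t i z.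

Lemma pooled_simplex t : (0 < t)%N -> simplex (r t).
Proof.
move=> t0; split=> [z|].
  by rewrite mulr_ge0 ?invr_ge0 ?ler0n // sumr_ge0 // => i _; rewrite sumr_ge0.
rewrite /r -mulr_sumr exchange_big /= (eq_bigr (fun i => (l t i)%:R)).
  by rewrite -natr_sum mulVf // pnatr_eq0 -lt0n total_deliberate_gt0.
by move=> i _; rewrite sum_s.
Qed.

Lemma pooled_weights t z : (0 < t)%N -> r t z = \sum_i (l t i)%:R / (Lam t)%:R * q t i z.
Proof.
move=> t0; rewrite /r mulr_sumr; apply: eq_bigr => i _.
rewrite /q /empirical -/(l t i) -/(s t i z) mulrA; congr (_ * _).
rewrite mulrAC mulfV ?mul1r // pnatr_eq0 -lt0n; exact: num_deliberate_gt0.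
Qed.

(** The inverse of the share is the sum over [j] of l_j / l_i, which tends to [n]. *)
Lemma share_cvg i : (l t i)%:R / (Lam t)%:R @[t --> \oo] --> (n%:R^-1 : R).
Proof.
have h : \sum_j (l t j)%:R / (l t i)%:R @[t --> \oo] --> (\sum_(j < n) 1 : R).
  apply: (cvg_sum_seq _ (f := fun j t => (l t j)%:R / (l t i)%:R) (l := fun=> 1)).
  by move=> j; exact: l_ratio.
have nE : (\sum_(j < n) 1 : R) = n%:R by rewrite sumr_const card_ord.
rewrite nE in h.
have n_neq0 : n%:R != 0 :> R by rewrite pnatr_eq0 -lt0n.
suff -> : (fun t => (l t i)%:R / (Lam t)%:R) =
  (fun t => (\sum_j (l t j)%:R / (l t i)%:R : R)^-1) by exact: cvgV n_neq0 h.
by apply/funext => t; rewrite -mulr_suml invfM invrK mulrC -natr_sum.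
Qed.

(** Both are averages of the same [q t i], with weights l_i / Lam and 1 / n. *)
Lemma pooled_centroid : dist1 (r t) (centroid (q t)) @[t --> \oo] --> 0.
Proof.
have h : \sum_i #|Y|%:R * `|(l t i)%:R / (Lam t)%:R - n%:R^-1| @[t --> \oo] -->
    (\sum_(i < n) 0 : R).
  apply: (cvg_sum_seq _ (l := fun=> 0)
    (f := fun i t => #|Y|%:R * `|(l t i)%:R / (Lam t)%:R - n%:R^-1|)) => i.
  rewrite -(mulr0 #|Y|%:R); apply: cvgM; first exact: cvg_cst.
  rewrite -(normr0 R); apply: cvg_norm; rewrite -(subrr (n%:R^-1 : R)).
  by apply: cvgB; [exact: share_cvg|exact: cvg_cst].
rewrite big1_eq in h; apply: squeeze_cvgr (cvg_cst 0) h.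
exists 1%N => // t t0; rewrite dist1_ge0 andTb.
have -> : dist1 (r t) (centroid (q t)) =
    \sum_z `|\sum_i ((l t i)%:R / (Lam t)%:R * q t i z - n%:R^-1 * q t i z)|.
  apply: eq_bigr => z _; congr (`|_|); rewrite (pooled_weights z t0).
  by rewrite /centroid mulr_sumr -sumrB.
apply: (@le_trans _ _ (\sum_(z : Y) \sum_i `|(l t i)%:R / (Lam t)%:R - n%:R^-1|)).
  apply: ler_sum => z _; apply: le_trans (ler_norm_sum _ _ _) _.
  apply: ler_sum => i _; rewrite -mulrBl normrM ler_piMr //.
  have /andP[h0 h1] := simplex_cube (empirical_simplex t0 i) z.
  by rewrite ger0_norm.
by rewrite exchange_big; apply: ler_sum => i _; rewrite sumr_const [leRHS]mulr_natl.
Qed.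

Let sym i z x : deviation_value v i z x = W z x.
Proof. exact: deviation_value_symmetric. Qed.

Lemma best_response_gap t i : (2 <= t)%N ->
  gap z0 W (pure R (b t.-1 i w)) (centroid (q t.-1)) <= eta t.
Proof.
move=> t2; have h := @best_response t i t2.
rewrite /gap sum_pure lerBlDr; apply: best_value_le => z.
have := h z; rewrite !(mixed_utility_deviate u i _ (centroid (q t.-1))) !sum_pure.
have uE z' : deviation_value (u i) i z' (centroid (q t.-1)) = W z' (centroid (q t.-1)).
  rewrite -(sym i); congr (deviation_value _ _ _ _); apply/funext => y.
  exact: u_identical.
by rewrite !uE lerBlDr addrC.
Qed.

Lemma centroid_gap_to0 : self_gap v i0 z0 (centroid (q t)) @[t --> \oo] --> 0.
Proof.
(* The shift by two reflects that frequencies exist from round 1 on and selections act from round 2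
   on: step [t] leads from [r t.+1] to [r t.+2]. *)
pose gam t : R := (active t.+2)%:R / (Lam t.+2)%:R.
(* The average of the deliberate actions of the round. When nobody is active the step size is 0, and
   any point of the simplex will do. *)
pose c t z : R := if active t.+2 == 0%N then r t.+1 z else
  (active t.+2)%:R^-1 * \sum_(i | X t.+2 i w) pure R (b t.+1 i w) z.
have Lam_neq0 t : (Lam t.+1)%:R != 0 :> R.
  by rewrite pnatr_eq0 -lt0n total_deliberate_gt0.
have activeE t : (active t)%:R = \sum_(i | X t i w) (1 : R).
  by rewrite /active natr_sum [RHS]big_mkcond; apply: eq_bigr => i _; case: (X t i w).
have sc t : simplex (c t).
  rewrite /c; have [_|act] := eqVneq (active t.+2) 0%N.
    have -> : (fun z => r t.+1 z) = r t.+1 by apply/funext.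
    exact: pooled_simplex.
  split=> [z|].
    by rewrite mulr_ge0 ?invr_ge0 ?ler0n // sumr_ge0.
  rewrite -mulr_sumr exchange_big /= (eq_bigr (fun=> 1)); last first.
    by move=> i _; exact: (simplex_pure R _).2.
  by rewrite -activeE mulVf // pnatr_eq0.
pose K := total_weight v * n%:R.
pose C := 2 * K * #|Y|%:R.
(* The second term is the cost of measuring the gap against [r] although the players respond to the
   centroid. *)
pose eps t := eta t.+2 + C * dist1 (r t.+1) (centroid (q t.+1)).
have main : self_gap v i0 z0 (r t.+1) @[t --> \oo] --> 0.
  apply: (@best_response_process R n Y v i0 z0 sym (fun t => r t.+1) c gam eps).
  - by move=> t; exact: pooled_simplex.
  - exact: sc.
  - move=> t z; rewrite /gam /c.
    have rS : (Lam t.+2)%:R * r t.+2 z = (Lam t.+1)%:R * r t.+1 z +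
        \sum_(i | X t.+2 i w) pure R (b t.+1 i w) z.
      rewrite /r !mulrA !mulfV // !mul1r [X in _ + X]big_mkcond -big_split /=.
      apply: eq_bigr => i _; rewrite /s big_mkcond big_nat_recr //= -big_mkcond /=.
      congr (_ + _); case: ifP => // Xi.
      by rewrite (@deliberate_action t.+2 i isT Xi).
    have L2 := Lam_neq0 t.+1.
    apply: (mulfI L2); rewrite rS.
    have -> : (Lam t.+2)%:R = (Lam t.+1)%:R + (active t.+2)%:R :> R.
      by rewrite total_deliberateS natrD.
    have L2' : (Lam t.+1)%:R + (active t.+2)%:R != 0 :> R.
      by rewrite -natrD -total_deliberateS.
    have h (x k y : R) : x != 0 -> x * (k / x * y) = k * y by move=> x0; field.
    rewrite mulrDr h //.
    have [a0|act] := eqVneq (active t.+2) 0%N.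
      rewrite a0 mul0r !addr0 big1 ?addr0 // => i Xi; exfalso.
      by move: a0; rewrite /active (bigD1 i) //= Xi.
    have h' (k x y : R) : k != 0 -> k * (k^-1 * x - y) = x - k * y by move=> k0; field.
    rewrite h' ?pnatr_eq0 //; ring.
  - by move=> t; rewrite divr_ge0.
  - apply: cvg0_of_lt => e e0.
    have [m Hm] : exists m : nat, n%:R / e < m%:R.
      by exists (Num.bound (n%:R / e)); rewrite archi_boundP // divr_ge0 // ltW.
    have [t0 Ht0] := l_pinfty i0 m.
    exists t0 => t t0t; rewrite ger0_norm ?divr_ge0 //.
    have ml : (m <= Lam t.+2)%N.
      apply: leq_trans (total_deliberate_mono (leq_trans t0t (leq_trans (leqnSn _) (leqnSn _)))).
      by apply: leq_trans Ht0 _; rewrite /Lam (bigD1 i0) //= leq_addr.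
    rewrite ltr_pdivrMr ?ltr0n ?total_deliberate_gt0 //.
    apply: (@le_lt_trans _ _ n%:R); first by rewrite ler_nat active_le.
    rewrite mulrC -ltr_pdivrMr //; apply: lt_le_trans Hm _.
    by rewrite ler_nat.
  - rewrite -(addr0 0); apply: cvgD.
      by have := eta_to0; rewrite -(cvg_shiftS eta) -(cvg_shiftS (fun t => eta t.+1)).
    rewrite -(mulr0 C); apply: cvgM; first exact: cvg_cst.
    have := pooled_centroid; rewrite -(cvg_shiftS (fun t => dist1 (r t) (centroid (q t)))).
    exact.
  (* Waiting until the total count has doubled makes the steps add up to at least (Lam M.+1 - Lam
     N.+1) / Lam M.+1, hence to at least 1 / 2. *)
  - move=> N; have [M HM] := l_pinfty i0 (2 * Lam N.+1)%N; exists M.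
    have HM' : (2 * Lam N.+1 <= Lam M.+1)%N.
      apply: leq_trans (total_deliberate_mono (leqnSn M)).
      by apply: leq_trans HM _; rewrite /Lam (bigD1 i0) //= leq_addr.
    have NM : (N <= M)%N.
      rewrite leqNgt; apply/negP => MN.
      have := leq_trans HM' (total_deliberate_mono (ltnW (n := N.+1) (m:= M.+1) MN)).
      by rewrite mul2n -addnn -[X in (_ <= X)%N]addn0 leq_add2l leqNgt total_deliberate_gt0.
    have tele : (Lam M.+1)%:R - (Lam N.+1)%:R = \sum_(N <= k < M) (active k.+2)%:R :> R.
      rewrite -(telescope_sumr (fun k => (Lam k.+1)%:R : R)) //.
      by apply: eq_bigr => k _; rewrite total_deliberateS natrD addrC addKr.
    apply: (@le_trans _ _ (\sum_(N <= k < M) (active k.+2)%:R / (Lam M.+1)%:R)); last first.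
      apply: ler_sum_nat => k /andP[_ kM]; rewrite ler_wpM2l //.
      by rewrite lef_pV2 ?posrE ?ltr0n ?total_deliberate_gt0 // ler_nat total_deliberate_mono.
    rewrite -mulr_suml -tele mulrBl mulfV //.
    rewrite lerBrDr -lerBrDl ler_pdivrMr ?ltr0n ?total_deliberate_gt0 //.
    have : (2 * Lam N.+1)%:R <= (Lam M.+1)%:R :> R by rewrite ler_nat.
    by rewrite natrM; lra.
  - exists 0%N => // t _ /=; rewrite /gam.
    have [->|act] := eqVneq (active t.+2) 0%N; first by rewrite !mul0r.
    apply: ler_wpM2l; first by rewrite divr_ge0.
    have cc : cube (c t) by exact/simplex_cube/sc.
    have cr : cube (r t.+1) by apply/simplex_cube/pooled_simplex.
    have cq : cube (centroid (q t.+1)).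
      by apply/simplex_cube/centroid_simplex => //; exact: empirical_simplex.
    have := @gap_lipschitz R Y z0 W K (deviation_value_lipschitz v i0) (total_weight v)
      (deviation_value_bound v i0) _ _ _ _ cc cc cr cq.
    have -> : dist1 (c t) (c t) = 0.
      by rewrite /dist1 big1 // => z _; rewrite subrr normr0.
    rewrite mulr0 add0r -/C ler_norml => /andP[_ h].
    suff : gap z0 W (c t) (centroid (q t.+1)) <= eta t.+2.
      by rewrite /eps; move: h; rewrite -/W; lra.
    rewrite /gap /c (negbTE act).
    under eq_bigr do rewrite -mulrA mulr_suml.
    rewrite -mulr_sumr exchange_big /= mulrC ler_pdivrMr ?ltr0n ?lt0n //.
    rewrite activeE mulr_sumr; apply: ler_sum => i _; rewrite mulr1.
    exact: (@best_response_gap t.+2 i isT).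
have Clip := self_gap_lipschitz v i0 z0.
set D := (X in lipschitz1 X) in Clip.
have dC : D * dist1 (r t.+1) (centroid (q t.+1)) @[t --> \oo] --> 0.
  rewrite -(mulr0 D); apply: cvgM; first exact: cvg_cst.
  have := pooled_centroid; rewrite -(cvg_shiftS (fun t => dist1 (r t) (centroid (q t)))).
  exact.
rewrite -(cvg_shiftS (fun t => self_gap v i0 z0 (centroid (q t)))).
have sumC : self_gap v i0 z0 (r t.+1) + D * dist1 (r t.+1) (centroid (q t.+1))
    @[t --> \oo] --> 0.
  by rewrite -(addr0 0); exact: cvgD main dC.
apply: (squeeze_cvgr _ (cvg_cst 0) sumC).
exists 0%N => // t _ /=.
have cr : cube (r t.+1) by apply/simplex_cube/pooled_simplex.
have sq : simplex (centroid (q t.+1)) by apply: centroid_simplex => //; exact: empirical_simplex.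
rewrite gap_ge0 /=; last exact: sq.1.
have := Clip _ _ cr (simplex_cube sq); rewrite ler_norml => /andP[h _].
by move: h; lra.
Qed.

End Path.

(** * Law of large numbers for conditional probabilities *)

(** The sum counts the positive multiples of [delta] below [x], but no more than [n] of them; the
    first case is the saturated one. *)
Lemma staircase_approx (R : realType) (delta x : R) (n : nat) : 0 < delta -> 0 <= x ->
  let S := \sum_(j < n) delta * (j.+1%:R * delta <= x)%R%:R in
  if n%:R * delta <= x then S = n%:R * delta else x - delta <= S <= x.
Proof.
move=> d0 x0; elim: n => [|n IH] /=.
  by rewrite big_ord0 mul0r x0.
rewrite big_ord_recr /=; move: IH => /=; set S := \sum_(j < n) _.
have nS : n.+1%:R * delta = n%:R * delta + delta by rewrite -natr1 mulrDl mul1r.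
case: ifP => [h|/negbT h]; case: ifP => [h'|/negbT h'].
- by rewrite h' mulr1 nS => ->.
- by rewrite (negbTE h') mulr0 addr0 => ->; rewrite -ltNge nS in h'; apply/andP; split; lra.
- by rewrite -ltNge in h; move: h'; rewrite nS => h'; exfalso; lra.
- by rewrite (negbTE h') mulr0 addr0.
Qed.

Section Bounded.
Context {R : realType} {d : measure_display} {Omega : measurableType d}.
Context (P : probability Omega R).

Definition bounded_measurable (f : Omega -> R) : Prop :=
  measurable_fun setT f /\ exists M, forall w, `|f w| <= M.

Lemma bounded_measurable_integrable f : bounded_measurable f ->
  P.-integrable setT (EFin \o f).
Proof.
move=> [mf [M fM]]; apply: measurable_bounded_integrable => //.
  by rewrite -ge0_fin_numE //; exact: fin_num_measure.
exists M; split; rewrite ?num_real // => x Mx w _ /=.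
exact: le_trans (fM w) (ltW Mx).
Qed.

Lemma bounded_measurable_cst r : bounded_measurable (fun=> r).
Proof. by split; [exact: measurable_cst|exists `|r|]. Qed.

Lemma bounded_measurableD f g : bounded_measurable f -> bounded_measurable g ->
  bounded_measurable (fun w => f w + g w).
Proof.
move=> [mf [M fM]] [mg [N gN]]; split; first exact: measurable_funD.
exists (M + N) => w; apply: le_trans (ler_normD _ _) _; exact: lerD.
Qed.

Lemma bounded_measurableM f g : bounded_measurable f -> bounded_measurable g ->
  bounded_measurable (fun w => f w * g w).
Proof.
move=> [mf [M fM]] [mg [N gN]]; split; first exact: measurable_funM.
by exists (M * N) => w; rewrite normrM ler_pM.
Qed.

Lemma bounded_measurableB f g : bounded_measurable f -> bounded_measurable g ->
  bounded_measurable (fun w => f w - g w).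
Proof.
move=> hf hg.
have := bounded_measurableD hf (bounded_measurableM (bounded_measurable_cst (-1)) hg).
by under eq_fun do rewrite mulN1r.
Qed.

Lemma bounded_measurable_sum n (f : nat -> Omega -> R) :
  (forall k, (k < n)%N -> bounded_measurable (f k)) ->
  bounded_measurable (fun w => \sum_(k < n) f k w).
Proof.
elim: n => [|n IH] h.
  by under eq_fun do rewrite big_ord0; exact: bounded_measurable_cst.
under eq_fun do rewrite big_ord_recr /=.
by apply: bounded_measurableD; [apply: IH => k kn; apply: h; exact: ltnW|exact: h].
Qed.

Lemma bounded_measurable_indic (b : Omega -> bool) : measurable [set w | b w] ->
  bounded_measurable (fun w => (b w)%:R).
Proof.
move=> mb; split.
  have -> : (fun w => (b w)%:R : R) = \1_[set w | b w].
    by apply/funext => w; rewrite indicE; congr (nat_of_bool _)%:R; apply/idP/idP;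
      rewrite inE.
  exact: measurable_indic.
by exists 1 => w; case: (b w); rewrite ?normr0 ?normr1.
Qed.

Local Notation expect f := (\int[P]_w f w)%R.

Lemma expectD f g : bounded_measurable f -> bounded_measurable g ->
  expect (fun w => f w + g w) = expect f + expect g.
Proof.
by move=> hf hg; rewrite RintegralD //; exact: bounded_measurable_integrable.
Qed.

Lemma expectZ r f : bounded_measurable f -> expect (fun w => r * f w) = r * expect f.
Proof.
by move=> hf; rewrite RintegralZl //; exact: bounded_measurable_integrable.
Qed.

Lemma expect_cst r : expect (fun=> r) = r.
Proof.
rewrite Rintegral_cst //.
set x := fine _; suff -> : x = 1 by rewrite mulr1.
rewrite /x (_ : 1 = fine 1%E) //; congr fine; exact: (@probability_setT _ _ _ P).
Qed.

Lemma expect_le f g : bounded_measurable f -> bounded_measurable g ->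
  (forall w, f w <= g w) -> expect f <= expect g.
Proof.
by move=> hf hg fg; apply: le_Rintegral => //; exact: bounded_measurable_integrable.
Qed.

Lemma expect_sum0 n (f : nat -> Omega -> R) :
  (forall k, (k < n)%N -> bounded_measurable (f k)) ->
  (forall k, (k < n)%N -> expect (f k) = 0) ->
  expect (fun w => \sum_(k < n) f k w) = 0.
Proof.
elim: n => [|n IH] h h0.
  by under eq_Rintegral do rewrite big_ord0; rewrite expect_cst.
under eq_Rintegral do rewrite big_ord_recr /=.
rewrite expectD ?IH ?h0 ?addr0 //; try exact: h.
- by move=> k kn; apply: h; exact: ltnW.
- by move=> k kn; apply: h0; exact: ltnW.
- by apply: bounded_measurable_sum => k kn; apply: h; exact: ltnW.
Qed.

Section Centered.
Context (G : set (set Omega)) (GM : G `<=` measurable).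
Let TG : measurableType _ := g_sigma_algebraType G.

Definition adapted (f : Omega -> R) : Prop := @measurable_fun _ _ TG R setT f.

Lemma generated_measurable (A : set Omega) : <<s G >> A -> measurable A.
Proof.
by apply: smallest_sub => //; split=> [|B|B mB];
  [exact: measurable0|rewrite setTD; exact: measurableC|exact: bigcup_measurable].
Qed.

Lemma adapted_measurable f : adapted f -> measurable_fun setT f.
Proof. by move=> mf _ B mB; apply: generated_measurable; exact: mf. Qed.

Lemma adaptedP f : (forall B : set R, measurable B -> <<s G >> (f @^-1` B)) -> adapted f.
Proof. by move=> h _ B mB; rewrite setTI; exact: h. Qed.

(* The staircases below a bounded adapted function are combinations of
   indicators of events of the generated sigma-algebra. *)
Lemma expect_adapted_centered (f h : Omega -> R) (M : R) :
  adapted f -> (forall w, `|f w| <= M) ->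
  bounded_measurable h -> (forall w, `|h w| <= 1) ->
  (forall A, <<s G >> A -> expect (fun w => \1_A w * h w) = 0) ->
  expect (fun w => f w * h w) = 0.
Proof.
move=> af fM bh h1 h0.
have bf : bounded_measurable f by split; [exact: adapted_measurable|exists M].
have expect_h : expect h = 0.
  rewrite -(h0 setT); last exact: (@measurableT _ TG).
  by apply: eq_Rintegral => w _; rewrite indicT mul1r.
(* Adding the constant [M] to [f] does not change the integral against [h], whose expectation is
   0. *)
wlog f0 : f M af fM bf / forall w, 0 <= f w <= M.
  move=> H; have M0 : 0 <= M by apply: le_trans (fM point); exact: normr_ge0.
  have bM := bounded_measurable_cst M.
  have E1 : expect (fun w => (f w + M) * h w) = 0.
    apply: (H (fun w => f w + M) (2 * M)) => [||| w].
    - by apply: measurable_funD => //; exact: measurable_cst.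
    - move=> w; apply: le_trans (ler_normD _ _) _; rewrite (ger0_norm M0).
      by have := fM w; lra.
    - exact: bounded_measurableD.
    - by have := fM w; rewrite ler_norml => /andP[? ?]; apply/andP; split; lra.
  move: E1; under eq_Rintegral do rewrite mulrDl.
  by rewrite expectD ?expectZ ?expect_h ?mulr0 ?addr0 //; exact: bounded_measurableM.
have M0 : 0 <= M by have /andP[/le_trans] := f0 point; apply.
have small n : `|expect (fun w => f w * h w)| <= (M + 1) / n.+1%:R.
  (* The [n.+1] stairs reach [M + 1], which exceeds [f], so the staircase never saturates. *)
  set delta := (M + 1) / n.+1%:R.
  have d0 : 0 < delta by rewrite divr_gt0 // ltr_wpDl.
  pose A j := [set w | j.+1%:R * delta <= f w].
  have GA j : <<s G >> (A j).
    have -> : A j = f @^-1` `[j.+1%:R * delta, +oo[.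
      by apply/seteqP; split => w; rewrite /A /= in_itv /= andbT.
    by have := af measurableT _ (measurable_itv `[j.+1%:R * delta, +oo[); rewrite setTI.
  have bA j : bounded_measurable (\1_(A j)).
    split; first by apply: measurable_indic; exact: generated_measurable.
    by exists 1 => w; rewrite indicE; case: (_ \in _); rewrite ?normr0 ?normr1.
  pose g w := \sum_(j < n.+1) delta * \1_(A j) w.
  have bg : bounded_measurable g.
    apply: (@bounded_measurable_sum n.+1 (fun j w => delta * \1_(A j) w)) => j _.
    by apply: bounded_measurableM => //; exact: bounded_measurable_cst.
  have fg w : `|f w - g w| <= delta.
    have /andP[fw0 fwM] := f0 w.
    have := staircase_approx n.+1 d0 fw0; rewrite /=.
    have -> : \sum_(j < n.+1) delta * (j.+1%:R * delta <= f w)%R%:R = g w.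
      apply: eq_bigr => j _; rewrite indicE; congr (_ * (nat_of_bool _)%:R).
      by apply/idP/idP; rewrite inE.
    rewrite {1}/delta mulrC divfK ?pnatr_eq0 // ifF.
      by move=> /andP[? ?]; rewrite ler_norml; apply/andP; split; lra.
    by apply/negbTE; rewrite -ltNge; lra.
  have Eg : expect (fun w => g w * h w) = 0.
    under eq_Rintegral do rewrite /g mulr_suml.
    apply: (@expect_sum0 n.+1 (fun j w => delta * \1_(A j) w * h w)) => j _.
      do 2 apply: bounded_measurableM => //; exact: bounded_measurable_cst.
    under eq_Rintegral do rewrite -mulrA.
    by rewrite expectZ ?h0 ?mulr0 //; exact: bounded_measurableM.
  have bfg : bounded_measurable (fun w => (f w - g w) * h w).
    by apply: bounded_measurableM => //; exact: bounded_measurableB.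
  have Efg : expect (fun w => f w * h w) = expect (fun w => (f w - g w) * h w).
    rewrite -[LHS]subr0 -Eg -RintegralB //; first last.
    - by apply: bounded_measurable_integrable; exact: bounded_measurableM.
    - by apply: bounded_measurable_integrable; exact: bounded_measurableM.
    by apply: eq_Rintegral => w _; rewrite mulrBl.
  have bound w : `|(f w - g w) * h w| <= delta.
    rewrite normrM; apply: le_trans (fg w).
    by rewrite ler_piMr.
  rewrite Efg ler_norml; apply/andP; split.
    rewrite -[X in X <= _]expect_cst; apply: expect_le => //.
      exact: bounded_measurable_cst.
    by move=> w; have := bound w; rewrite ler_norml => /andP[].
  rewrite -[X in _ <= X](expect_cst delta); apply: expect_le => //.
    exact: bounded_measurable_cst.
  by move=> w; have := bound w; rewrite ler_norml => /andP[].
apply/eqP; rewrite -normr_le0; apply/ler_addgt0Pl => e e0; rewrite addr0.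
have M1 : 0 < M + 1 by rewrite ltr_wpDl.
have [n Hn] : exists n : nat, (M + 1) / e < n%:R.
  by exists (Num.bound ((M + 1) / e)); rewrite archi_boundP // divr_ge0 // ltW.
apply: le_trans (small n) _; rewrite ler_pdivrMr ?ltr0n // mulrC -ler_pdivrMr //.
by apply: le_trans (ltW Hn) _; rewrite ler_nat.
Qed.
End Centered.
End Bounded.

(** * Compensated counts and their second moments *)

Section CompensatedSums.
Context {R : realType} {Omega : Type} (x : nat -> Omega -> bool) (rho : nat -> Omega -> R).

Definition compensator t w : R := \sum_(k < t) rho k w.

(* The predictable truncation stops the compensated sum at the last time at
   which the compensator is at most [m]. *)
Definition truncation (m : R) k w : R := (compensator k.+1 w <= m)%R%:R.

Definition stopped_sum m t w : R :=
  \sum_(k < t) truncation m k w * ((x k w)%:R - rho k w).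

(** The predictable quadratic variation of [stopped_sum]: a Bernoulli increment has conditional
    variance rho (1 - rho), and the 0-1 truncation equals its square. *)
Definition stopped_variance m t w : R :=
  \sum_(k < t) truncation m k w * (rho k w * (1 - rho k w)).

End CompensatedSums.

Section Compensated.
Context {R : realType} {d : measure_display} {Omega : measurableType d}.
Context (P : probability Omega R).
Context (G : nat -> set (set Omega)) (x : nat -> Omega -> bool) (rho : nat -> Omega -> R).
Context (G_measurable : forall k, G k `<=` measurable).
Context (G_mono : forall k, G k `<=` G k.+1).
Context (x_adapted : forall k, <<s G k.+1 >> [set w | x k w]).
Context (rho_adapted : forall k, adapted (G k) (rho k)).
Context (rho01 : forall k w, 0 <= rho k w <= 1).
Local Notation expect f := (\int[P]_w f w)%R.
Context (centered : forall k A, <<s G k >> A ->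
  expect (fun w => \1_A w * ((x k w)%:R - rho k w)) = 0).

Lemma adapted_le k l f : (k <= l)%N -> adapted (R := R) (G k) f -> adapted (G l) f.
Proof.
move=> kl af _ B mB; have := af measurableT B mB.
apply: smallest_sub; first exact: smallest_sigma_algebra.
apply: subset_trans (@sub_sigma_algebra _ setT (G l)).
rewrite -(subnKC kl); elim: (l - k)%N => [|m IH]; first by rewrite addn0.
by rewrite addnS; apply: subset_trans IH _; exact: G_mono.
Qed.

Lemma adapted_indicator k (b : Omega -> bool) : <<s G k >> [set w | b w] ->
  adapted (R := R) (G k) (fun w => (b w)%:R).
Proof.
move=> Gb; have -> : (fun w => (b w)%:R) = \1_[set w | b w] :> (Omega -> R).
  by apply/funext => w; rewrite indicE; congr (nat_of_bool _)%:R; apply/idP/idP;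
    rewrite inE.
exact: (@measurable_indic _ (g_sigma_algebraType (G k)) R setT [set w | b w]).
Qed.

Lemma adapted_sum k n (f : nat -> Omega -> R) :
  (forall j, (j < n)%N -> adapted (G k) (f j)) ->
  adapted (G k) (fun w => \sum_(j < n) f j w).
Proof.
elim: n => [|n IH] h.
  by under eq_fun do rewrite big_ord0; exact: measurable_cst.
under eq_fun do rewrite big_ord_recr /=.
apply: measurable_funD; last exact: h.
by apply: IH => j jn; apply: h; exact: ltnW.
Qed.

Local Notation compensator := (compensator rho).
Local Notation truncation := (truncation rho).
Local Notation stopped_sum := (stopped_sum x rho).
Local Notation stopped_variance := (stopped_variance rho).

(** [compensator k.+1] involves [rho] only up to index [k], which is already known at stage [k]: the
    truncation is predictable. *)
Lemma truncation_adapted m k : adapted (G k) (truncation m k).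
Proof.
apply: adapted_indicator.
have mc : adapted (G k) (compensator k.+1).
  apply: adapted_sum => j jk; apply: (adapted_le _ (@rho_adapted j)).
  by rewrite -ltnS.
have -> : [set w | compensator k.+1 w <= m] = compensator k.+1 @^-1` `]-oo, m].
  by apply/seteqP; split => w /=; rewrite in_itv.
have h := mc measurableT _ (measurable_itv `]-oo, m]).
rewrite setTI in h; exact: h.
Qed.

Lemma truncation01 m k w : 0 <= truncation m k w <= 1.
Proof. by rewrite /truncation; case: (compensator _ _ <= m); rewrite ?lexx ?ler01. Qed.

Lemma x01 k w : (0 : R) <= (x k w)%:R <= (1 : R).
Proof. by case: (x k w); rewrite ?lexx ?ler01. Qed.

Lemma increment_le1 k w : `|(x k w)%:R - rho k w| <= 1.
Proof.
have /andP[x0 x1] := x01 k w; have /andP[r0 r1] := rho01 k w.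
by rewrite ler_norml; apply/andP; split; lra.
Qed.

Lemma stopped_sum_adapted m t : adapted (G t) (stopped_sum m t).
Proof.
apply: (@adapted_sum t t (fun k w => truncation m k w * ((x k w)%:R - rho k w))) => k kt.
apply: measurable_funM.
  by apply: (adapted_le _ (@truncation_adapted m k)); exact: ltnW.
apply: measurable_funB.
  by apply: (adapted_le _ (adapted_indicator (@x_adapted k))).
by apply: (adapted_le _ (@rho_adapted k)); exact: ltnW.
Qed.

Lemma stopped_sum_bound m t w : `|stopped_sum m t w| <= t%:R.
Proof.
apply: le_trans (ler_norm_sum _ _ _) _.
rewrite -[leRHS]mulr1 -[X in X%:R * _]card_ord mulr_natl -sumr_const.
apply: ler_sum => k _; rewrite normrM mulr_ile1 ?increment_le1 //.
by have /andP[h0 h1] := truncation01 m k w; rewrite ger0_norm.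
Qed.

Lemma stopped_variance_le m t w : 0 <= m -> stopped_variance m t w <= m.
Proof.
move=> m0.
suff : \sum_(k < t) truncation m k w * rho k w <= m.
  apply: le_trans; apply: ler_sum => k _.
  have /andP[h0 _] := truncation01 m k w; apply: ler_wpM2l => //.
  by have /andP[r0 r1] := rho01 k w; rewrite ler_piMr //; lra.
elim: t => [|t IH]; first by rewrite big_ord0.
(* If the level is exceeded at [t.+1] the last term is 0; otherwise the whole sum is at most the
   compensator, which is at most [m]. *)
have [h|h] := boolP (compensator t.+1 w <= m); last first.
  by rewrite big_ord_recr /= {2}/truncation (negbTE h) mul0r addr0.
apply: le_trans h; apply: ler_sum => k _.
have /andP[h0 h1] := truncation01 m k w; have /andP[r0 _] := rho01 k w.
by rewrite ler_piMl.
Qed.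

Lemma increment_bounded k : bounded_measurable (fun w => (x k w)%:R - rho k w).
Proof.
have xm : measurable [set w | x k w] by exact: (generated_measurable (@G_measurable k.+1)).
apply: bounded_measurableB; first exact: bounded_measurable_indic.
split; first exact: adapted_measurable (@G_measurable k) _ (@rho_adapted k).
exists 1 => w; have /andP[r0 r1] := rho01 k w; by rewrite ger0_norm.
Qed.

Lemma rho_bounded k : bounded_measurable (rho k).
Proof.
split; first exact: adapted_measurable (@G_measurable k) _ (@rho_adapted k).
by exists 1 => w; have /andP[r0 r1] := rho01 k w; rewrite ger0_norm.
Qed.

Lemma truncation_bounded m k : bounded_measurable (truncation m k).
Proof.
split; first exact: adapted_measurable (@G_measurable k) _ (@truncation_adapted m k).
by exists 1 => w; have /andP[r0 r1] := truncation01 m k w; rewrite ger0_norm.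
Qed.

Lemma stopped_sum_bounded m t : bounded_measurable (stopped_sum m t).
Proof.
apply: (@bounded_measurable_sum _ _ _ t
  (fun k w => truncation m k w * ((x k w)%:R - rho k w))) => k _.
by apply: bounded_measurableM; [exact: truncation_bounded|exact: increment_bounded].
Qed.

Lemma stopped_variance_bounded m t : bounded_measurable (stopped_variance m t).
Proof.
apply: (@bounded_measurable_sum _ _ _ t
  (fun k w => truncation m k w * (rho k w * (1 - rho k w)))) => k _.
apply: bounded_measurableM; first exact: truncation_bounded.
apply: bounded_measurableM; first exact: rho_bounded.
by apply: bounded_measurableB; [exact: bounded_measurable_cst|exact: rho_bounded].
Qed.

Let defect m t w := stopped_sum m t w ^+ 2 - stopped_variance m t w.

Let defect_bounded m t : bounded_measurable (defect m t).
Proof.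
apply: bounded_measurableB; last exact: stopped_variance_bounded.
by apply: bounded_measurableM; exact: stopped_sum_bounded.
Qed.

Lemma expect_defect m t : expect (defect m t) = 0.
Proof.
elim: t => [|t IH].
  under eq_Rintegral do rewrite /defect /stopped_sum /stopped_variance !big_ord0
    expr0n /= subrr.
  exact: expect_cst.
(* Because squares of 0-1 variables are the variables themselves, the increment of [defect] factors
   as a quantity known at stage [t] times the centered increment. *)
pose Z w := truncation m t w * (2 * stopped_sum m t w + (1 - 2 * rho t w)).
have dE w : defect m t.+1 w = defect m t w + Z w * ((x t w)%:R - rho t w).
  rewrite /defect /stopped_sum /stopped_variance !big_ord_recr /= /Z.
  rewrite -/(stopped_sum m t w) -/(stopped_variance m t w).
  have HH : truncation m t w * truncation m t w = truncation m t w.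
    by rewrite /truncation; case: (compensator _ _ <= m); rewrite ?mulr1 ?mulr0.
  have xx : (x t w)%:R * (x t w)%:R = (x t w)%:R :> R.
    by case: (x t w); rewrite ?mulr1 ?mulr0.
  rewrite expr2; set N := stopped_sum m t w; set Q := stopped_variance m t w.
  set y := (x t w)%:R in xx *; set h := truncation m t w in HH *; set r := rho t w.
  have -> : (N + h * (y - r)) * (N + h * (y - r)) =
    N * N + 2 * N * h * (y - r) + (h * h) * (y * y - 2 * y * r + r * r) by ring.
  rewrite HH xx; ring.
have aZ : adapted (G t) Z.
  apply: measurable_funM; first exact: truncation_adapted.
  apply: measurable_funD.
    by apply: measurable_funM; [exact: measurable_cst|exact: stopped_sum_adapted].
  apply: measurable_funB; first exact: measurable_cst.
  by apply: measurable_funM; [exact: measurable_cst|exact: rho_adapted].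
have ZM w : `|Z w| <= 2 * t%:R + 1.
  have := stopped_sum_bound m t w; rewrite /Z normrM.
  have /andP[h0 h1] := truncation01 m t w; rewrite (ger0_norm h0) => hN.
  apply: le_trans (ler_piMl _ h1) _ => //.
  apply: le_trans (ler_normD _ _) _; rewrite normrM ger0_norm //.
  have : `|1 - 2 * rho t w| <= 1.
    by have /andP[r0 r1] := rho01 t w; rewrite ler_norml; apply/andP; split; lra.
  lra.
have bZ : bounded_measurable Z.
  split; first exact: adapted_measurable (@G_measurable t) _ aZ.
  by exists (2 * t%:R + 1).
rewrite (@eq_Rintegral _ _ _ P setT (fun w => defect m t w + Z w * ((x t w)%:R - rho t w))); last first.
  by move=> w _; exact: dE.
rewrite expectD //; last by apply: bounded_measurableM => //; exact: increment_bounded.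
rewrite IH add0r.
apply: (expect_adapted_centered (@G_measurable t) aZ ZM (increment_bounded t)).
  exact: increment_le1.
exact: centered.
Qed.

(** The second moment of the stopped sum is the expected [stopped_variance], hence at most [m],
    uniformly in [t]. *)
Lemma stopped_sum_chebyshev m t c : 0 <= m -> 0 < c ->
  (P [set w | (c <= `|stopped_sum m t w|)%R] <= (m / c ^+ 2)%:E)%E.
Proof.
move=> m0 c0; set A := [set w | _].
have mN := (stopped_sum_bounded m t).1.
have mA : measurable A.
  have -> : A = (Num.norm \o stopped_sum m t) @^-1` `[c, +oo[.
    by apply/seteqP; split => w; rewrite /A /= in_itv /= andbT.
  rewrite -[X in measurable X]setTI; apply: measurableT_comp => //.
have bA : bounded_measurable (\1_A : Omega -> R).
  split; first exact: measurable_indic.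
  by exists 1 => w; rewrite indicE; case: (_ \in _); rewrite ?normr0 ?normr1.
have EA : (P A = (expect (\1_A : Omega -> R))%:E)%E.
  rewrite /Rintegral fineK ?integral_indic ?setIT //.
  exact: fin_num_measure.
rewrite EA lee_fin ler_pdivlMr ?exprn_gt0 // mulrC -expectZ //.
have -> : m = expect (fun w => defect m t w + m).
  by rewrite expectD ?expect_defect ?expect_cst ?add0r //; exact: bounded_measurable_cst.
apply: expect_le => [||w].
- by apply: bounded_measurableM => //; exact: bounded_measurable_cst.
- by apply: bounded_measurableD => //; exact: bounded_measurable_cst.
have := stopped_variance_le t w m0; rewrite indicE.
have [|_] := boolP (w \in A); last first.
  by rewrite mulr0 /defect; have := sqr_ge0 (stopped_sum m t w); lra.
rewrite inE /A /= => cN; rewrite mulr1 /defect.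
have : c ^+ 2 <= stopped_sum m t w ^+ 2.
  by rewrite -[leRHS]real_normK ?num_real // ler_pXn2r ?nnegrE // ltW.
lra.
Qed.

End Compensated.

(** * From stopped sums to the ratio of count and compensator, on one path *)

Section PathwiseLaw.
Context {R : realType} {Omega : Type}.
Context (x : nat -> Omega -> bool) (rho : nat -> Omega -> R) (w : Omega).
Context (rho01 : forall k, 0 <= rho k w <= 1).

Let S t := compensator rho t w.
Let L t : R := \sum_(k < t) (x k w)%:R.

Lemma compensator_mono : {homo S : s t / (s <= t)%N >-> s <= t}.
Proof.
apply: homo_leq => [//|t1 t2 t3|t]; first exact: le_trans.
by rewrite /S /compensator big_ord_recr /= lerDl; have /andP[] := rho01 t.
Qed.

Lemma count_mono : {homo L : s t / (s <= t)%N >-> s <= t}.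
Proof.
apply: homo_leq => [//|t1 t2 t3|t]; first exact: le_trans.
by rewrite /L big_ord_recr /= lerDl.
Qed.

Context (S_pinfty : forall m : R, exists t, m < S t).

(** [tau] is the last time at which the compensator is at most [m]. It is within 1 of [m] there
    because its increments are at most 1, and afterwards the stopped sum is frozen. *)
Lemma stopping_level m : 0 <= m -> exists tau, [/\ m - 1 < S tau, S tau <= m,
  (forall t, m < S t -> (tau < t)%N), (forall t, S t <= m -> (t <= tau)%N) &
  forall t, (tau < t)%N -> stopped_sum x rho m t w = L tau - S tau].
Proof.
move=> m0; case: (ex_minnP (S_pinfty m)) => -[|T].
  by rewrite /S /compensator big_ord0 ltNge m0.
move=> mT minT; exists T.
have TS : S T <= m.
  by rewrite leNgt; apply/negP => /minT; rewrite ltnn.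
split => //.
- move: mT; rewrite /S /compensator big_ord_recr /=.
  by have /andP[_] := rho01 T; lra.
- move=> t tm; rewrite leqNgt; apply/negP => Tt.
  by move: mT; rewrite ltNge (le_trans (compensator_mono Tt) tm).
move=> t Tt; rewrite /stopped_sum /L /S /compensator -sumrB.
rewrite [LHS](bigID (fun k : 'I_t => (k < T)%N)) /= [X in _ + X]big1 ?addr0.
  rewrite (big_ord_widen t (fun k => (x k w)%:R - rho k w) (ltnW Tt)).
  apply: eq_bigr => k kT; rewrite /truncation.
  have -> : compensator rho k.+1 w <= m by exact: le_trans (compensator_mono kT) TS.
  by rewrite mul1r.
move=> k; rewrite -leqNgt => Tk; rewrite /truncation.
have -> : (compensator rho k.+1 w <= m) = false; last by rewrite mul0r.
apply/negbTE; rewrite -ltNge; apply: lt_le_trans mT _.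
exact: compensator_mono.
Qed.

(** At the times where the compensator reaches the levels j^2, the stopped sum controls the count.
    Between two such times count and compensator are monotone, and the ratio of consecutive squares
    tends to 1. *)
Lemma count_compensator_ratio :
  (forall e : R, 0 < e -> exists J : nat, forall j, (J <= j)%N ->
    forall T, exists2 t, (T <= t)%N &
      `|stopped_sum x rho (j.+1%:R ^+ 2) t w| < e * j.+1%:R ^+ 2) ->
  L t / S t @[t --> \oo] --> (1 : R).
Proof.
move=> small; apply/cvgrPdist_le => e e0.
have e8 : 0 < e / 8 by lra.
have [J HJ] := small _ e8.
(* Beyond [8 / e] the spacing 2j + 1 of consecutive squares is at most 3e/8 times j^2. *)
pose J1 := maxn J.+1 (Num.bound (8 / e)).+1.
have level j : (J < j)%N -> exists tau, [/\ `|L tau - S tau| <= e / 8 * j%:R ^+ 2,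
    j%:R ^+ 2 - 1 < S tau, S tau <= j%:R ^+ 2,
    (forall t, j%:R ^+ 2 < S t -> (tau < t)%N) & (forall t, S t <= j%:R ^+ 2 -> (t <= tau)%N)].
  case: j => // j Jj.
  have [tau [h1 h2 h3 h4 h5]] := stopping_level (sqr_ge0 (j.+1%:R : R)).
  exists tau; split => //.
  (* The stopped sum is frozen after [tau], so one good time after [tau] gives the bound at
     [tau]. *)
  have [t tt st] := HJ j Jj tau.+1.
  by rewrite -(h5 t) // ltW.
have [T HT] := S_pinfty (J1%:R ^+ 2).
exists T => // t /= Tt.
have JS : J1%:R ^+ 2 < S t by exact: lt_le_trans HT (compensator_mono Tt).
have S0 : 0 < S t by apply: le_lt_trans JS; exact: sqr_ge0.
have exj : exists j, S t <= j.+1%:R ^+ 2.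
  exists (Num.bound (S t)).
  have h := archi_boundP (ltW S0).
  apply: le_trans (ltW h) _; apply: (@le_trans _ _ (Num.bound (S t)).+1%:R).
    by rewrite ler_nat.
  by rewrite -[leLHS]mulr1 expr2 ler_wpM2l // ler1n.
case: (ex_minnP exj) => j Sj minj.
have J1j : (J1 <= j)%N.
  rewrite -ltnS -(ltr_nat R) -(ltr_pXn2r (n := 2)) ?nnegrE //.
  exact: lt_le_trans JS Sj.
have j0 : (0 < j)%N by apply: leq_trans J1j; rewrite leq_max.
have jS : j%:R ^+ 2 < S t.
  rewrite ltNge; apply/negP; case: j j0 minj {Sj J1j} => // j _ minj /minj.
  by rewrite ltnn.
have Jj : (J < j)%N by apply: leq_trans J1j; rewrite leq_max leqnn.
have [tau [a1 a2 a3 a4 a5]] := level j Jj.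
have [tau' [b1 b2 b3 b4 b5]] := level j.+1 (ltnW Jj).
have tau_t := count_mono (ltnW (a4 t jS)).
have t_tau' := count_mono (b5 t Sj).
have j8 : 8 / e <= j%:R.
  have h : 8 / e < (Num.bound (8 / e))%:R by apply: archi_boundP; rewrite divr_ge0 // ltW.
  apply: le_trans (ltW h) _; rewrite ler_nat.
  by apply: leq_trans J1j; rewrite leq_max leqnSn orbT.
have j1 : 1 <= j%:R :> R by rewrite ler1n.
have jj : 8 * j%:R <= e * j%:R ^+ 2.
  rewrite expr2 mulrA ler_wpM2r //.
  by rewrite mulrC -ler_pdivrMr.
have jS1 : j.+1%:R ^+ 2 = j%:R ^+ 2 + 2 * j%:R + 1 :> R.
  by rewrite -natr1; ring.
have jj1 : j%:R <= j%:R ^+ 2 :> R by rewrite expr2 -[leLHS]mulr1 ler_wpM2l.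
rewrite jS1 in Sj b1 b2 b3.
set q := j%:R ^+ 2 in jS Sj a1 a2 a3 b1 b2 b3 jj jj1; set r := j%:R in Sj b1 b2 b3 j1 jj jj1.
have eq : e / 8 * (q + 2 * r + 1) <= e / 2 * q.
  have : e / 8 * (q + 2 * r + 1) <= e / 8 * (4 * q) by apply: ler_wpM2l; lra.
  lra.
have key : `|S t - L t| <= e * q.
  move: a1 b1; rewrite !ler_norml => /andP[a11 a12] /andP[b11 b12].
  have eq0 : e / 8 * q <= e / 2 * q by apply: ler_wpM2r; lra.
  apply/andP; split; lra.
have S0' : S t != 0 by rewrite gt_eqF.
rewrite -[X in X - _](divff S0') -mulrBl normrM normfV (gtr0_norm S0).
rewrite ler_pdivrMr //; apply: le_trans key _.
by rewrite ler_pM2l // ltW.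
Qed.
End PathwiseLaw.

(** The term 2 / (N + 1) is what makes the induction close: 1 / a^2 is at most 2 / (a (a + 1)) for a
    >= 1, and the latter telescopes. *)
Lemma sum_inv_sqr_le (R : realType) (N : nat) :
  \sum_(0 <= j < N) (j.+1%:R ^+ 2)^-1 <= 2 - 2 / N.+1%:R :> R.
Proof.
elim: N => [|N IH]; first by rewrite big_geq // divr1 subrr.
rewrite big_nat_recr //=; apply: le_trans (lerD IH (lexx _)) _.
set a : R := N.+1%:R; have a1 : 1 <= a by rewrite ler1n.
have -> : N.+2%:R = a + 1 by rewrite natr1.
have a0 : 0 < a by lra.
have a10 : 0 < a + 1 by lra.
have : (a ^+ 2)^-1 <= 2 / a - 2 / (a + 1).
  have -> : 2 / a - 2 / (a + 1) = 2 / (a * (a + 1)) by field; lra.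
  rewrite -[leLHS]mul1r ler_pdivrMr ?exprn_gt0 // mulrAC ler_pdivlMr ?mulr_gt0 //.
  by rewrite mul1r expr2; nra.
set p := (a ^+ 2)^-1; set s := 2 / a; set t := 2 / (a + 1).
lra.
Qed.

(** * Strong law for events with given conditional probabilities *)

Section ConditionalLaw.
Context {R : realType} {d : measure_display} {Omega : measurableType d}.
Context (P : probability Omega R).
Local Notation expect f := (\int[P]_w f w)%R.

Section Law01.
Context (G : nat -> set (set Omega)) (x : nat -> Omega -> bool) (rho : nat -> Omega -> R).
Context (G_measurable : forall k, G k `<=` measurable).
Context (G_mono : forall k, G k `<=` G k.+1).
Context (x_adapted : forall k, <<s G k.+1 >> [set w | x k w]).
Context (rho_adapted : forall k, adapted (G k) (rho k)).
Context (rho01 : forall k w, 0 <= rho k w <= 1).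
Context (centered : forall k A, <<s G k >> A ->
  expect (fun w => \1_A w * ((x k w)%:R - rho k w)) = 0).

Let large m c t := [set w | c <= `|stopped_sum x rho m t w|].

Let large_measurable m c t : measurable (large m c t).
Proof.
have -> : large m c t = (Num.norm \o stopped_sum x rho m t) @^-1` `[c, +oo[.
  by apply/seteqP; split => w; rewrite /large /= in_itv /= andbT.
rewrite -[X in measurable X]setTI; apply: measurableT_comp => //.
by have [] := stopped_sum_bounded G_measurable G_mono x_adapted rho_adapted rho01 m t.
Qed.

(** The stopped sum is large at all late times. As an increasing union of events each contained in
    some [large m c T], it inherits their uniform bound; outside it there are arbitrarily late good
    times, as [count_compensator_ratio] requires. *)
Let persistent m c := \bigcup_T \bigcap_(t in [set t | (T <= t)%N]) large m c t.

Let persistent_measurable m c : measurable (persistent m c).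
Proof.
apply: bigcupT_measurable => T; apply: bigcap_measurable => [|t _] //.
by exists T => /=.
Qed.

Lemma persistent_le m c : 0 <= m -> 0 < c -> (P (persistent m c) <= (m / c ^+ 2)%:E)%E.
Proof.
move=> m0 c0.
have mT T : measurable (\bigcap_(t in [set t | (T <= t)%N]) large m c t).
  by apply: bigcap_measurable => [|t _] //; exists T => /=.
have := @nondecreasing_cvg_mu _ _ _ P
  (fun T => \bigcap_(t in [set t | (T <= t)%N]) large m c t) mT (persistent_measurable m c).
move=> /(_ _)/cvg_lim <- //; last first.
  move=> T1 T2 T12; apply/subsetPset => w h t /= T2t; apply: h => /=.
  exact: leq_trans T12 T2t.
apply: lime_le.
  apply: ereal_nondecreasing_is_cvgn => T1 T2 T12; apply: le_measure; rewrite ?inE //.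
  move=> w h t /= T2t; apply: h => /=; exact: leq_trans T12 T2t.
apply: nearW => T /=.
apply: (@le_trans _ _ (P (large m c T))).
  by apply: le_measure; rewrite ?inE // => w h; apply: h => /=.
exact: (stopped_sum_chebyshev G_measurable G_mono x_adapted rho_adapted rho01 centered).
Qed.

Lemma adapted_slln : {ae P, forall w, (forall m : R, exists t, m < compensator rho t w) ->
  (\sum_(k < t) (x k w)%:R) / compensator rho t w @[t --> \oo] --> (1 : R)}.
Proof.
pose e i : R := i.+1%:R^-1.
have e0 i : 0 < e i by rewrite invr_gt0.
(* With level (j + 1)^2 and threshold e_i (j + 1)^2 the bound m / c^2 equals 1 / (e_i (j + 1))^2,
   which is summable in [j], as Borel-Cantelli asks for each of the countably many [e i]. *)
pose B i j := persistent (j.+1%:R ^+ 2) (e i * j.+1%:R ^+ 2).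
have Bnull i : P (lim_sup_set (B i)) = 0%E.
  apply: lim_sup_set_cvg0 => [j|]; first exact: persistent_measurable.
  apply: (@le_lt_trans _ _ ((e i ^+ 2)^-1 * 2)%:E); last exact: ltry.
  apply: lime_le; first by apply: is_cvg_nneseries => j _ _; exact: measure_ge0.
  apply: nearW => N /=.
  apply: (@le_trans _ _ (\sum_(0 <= j < N) ((e i ^+ 2)^-1 * (j.+1%:R ^+ 2)^-1)%:E)%E).
    apply: lee_sum => j _; rewrite /B.
    have j0 : 0 < (j.+1%:R : R) ^+ 2 by rewrite exprn_gt0.
    apply: le_trans (persistent_le (ltW j0) _) _; first by rewrite mulr_gt0.
    rewrite lee_fin exprMn invfM mulrCA ler_pM2l ?invr_gt0 ?exprn_gt0 //.
    by rewrite [X in _ / X]expr2 invfM mulrA divff ?mul1r // gt_eqF.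
  rewrite sumEFin lee_fin -mulr_sumr ler_wpM2l ?invr_ge0 ?exprn_ge0 ?(ltW (e0 i)) //.
  by apply: le_trans (sum_inv_sqr_le R N) _; rewrite gerBl divr_ge0.
have ae_not : {ae P, forall w, forall i, ~ lim_sup_set (B i) w}.
  apply: ae_foralln => i; exists (lim_sup_set (B i)); split; [|exact: Bnull|].
    by apply: bigcap_measurable => // k _; apply: bigcup_measurable => j _;
      exact: persistent_measurable.
  by move=> w /= /contrapT.
apply: filterS ae_not => w hw Sinf.
apply: count_compensator_ratio => // eps eps0.
have [i Hi] : exists i : nat, e i < eps.
  have [N _ h] := near_infty_natSinv_lt (PosNum eps0).
  by exists N; apply: h => /=.
have [J HJ] : exists J : nat, forall j, (J <= j)%N -> ~ B i j w.
  apply: contrapT => H; apply: (hw i) => J _.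
  apply: contrapT => H1; apply: H; exists J => j Jj Bj.
  by apply: H1; exists j.
exists J => j Jj T; apply: contrapT => H.
apply: (HJ j Jj); exists T => // t /= Tt.
rewrite /large /= leNgt; apply/negP => h; apply: H; exists t => //.
by apply: lt_le_trans h _; rewrite ler_wpM2r ?exprn_ge0 // ltW.
Qed.
End Law01.

Lemma negligible_of_integral_le0 (h : Omega -> R) (A : set Omega) : measurable A ->
  P.-integrable setT (EFin \o h) -> (forall w, A w -> 0 < h w) ->
  (\int[P]_(w in A) (h w)%:E <= 0)%E -> {ae P, forall w, ~ A w}.
Proof.
move=> mA ih h0 int0.
have mh : measurable_fun A (EFin \o h).
  by apply: measurable_funTS; exact: (measurable_int P ih).
have : ae_eq P A (EFin \o h) (cst 0%E).
  apply/(ae_eq_integral_abs P mA mh).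
  apply/eqP; rewrite eq_le; apply/andP; split; last first.
    by apply: integral_ge0 => w _; exact: abse_ge0.
  apply: le_trans int0; rewrite le_eqVlt; apply/orP; left; apply/eqP.
  apply: eq_integral => w; rewrite inE => Aw; rewrite gee0_abs //.
  by rewrite lee_fin ltW // h0.
apply: filterS => w hw Aw; have := hw Aw; have := h0 w Aw => /= + [hw0].
by rewrite hw0 ltxx.
Qed.

(** The defining identity is tested on the events r < 0 and r > 1, which belong to the conditioning
    sigma-algebra. *)
Lemma cond_prob_ae01 (G : set (set Omega)) (E : set Omega) (r : Omega -> R) :
  G `<=` measurable -> measurable E -> is_cond_prob P <<s G >> E r ->
  {ae P, forall w, 0 <= r w <= 1}.
Proof.
move=> GM mE [ar ir cr].
have i0 c : P.-integrable setT (EFin \o (fun=> c : R)).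
  exact/bounded_measurable_integrable/bounded_measurable_cst.
have lo : {ae P, forall w, ~ [set w | r w < 0] w}.
  have GA : <<s G >> [set w | r w < 0].
    have -> : [set w | r w < 0] = r @^-1` `]-oo, 0[.
      by apply/seteqP; split => w /=; rewrite in_itv.
    exact: ar.
  have mA := generated_measurable GM GA.
  apply: (@negligible_of_integral_le0 (fun w => 0 - r w)) => //.
  - by have := integrableB measurableT (i0 0) ir; apply: eq_integrable.
  - by move=> w /=; rewrite sub0r oppr_gt0.
  rewrite integralB_EFin //; [|exact: integrableS (i0 0)|exact: integrableS ir].
  by rewrite cr // integral0 sub0e oppe_le0 measure_ge0.
have hi : {ae P, forall w, ~ [set w | 1 < r w] w}.
  have GA : <<s G >> [set w | 1 < r w].
    have -> : [set w | 1 < r w] = r @^-1` `]1, +oo[.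
      by apply/seteqP; split => w /=; rewrite in_itv /= andbT.
    exact: ar.
  have mA := generated_measurable GM GA.
  apply: (@negligible_of_integral_le0 (fun w => r w - 1)) => //.
  - by have := integrableB measurableT ir (i0 1); apply: eq_integrable.
  - by move=> w /=; rewrite subr_gt0.
  rewrite integralB_EFin //; [|exact: integrableS ir|exact: integrableS (i0 1)].
  rewrite cr // integral_cst // mul1e sube_le0.
  by apply: le_measure; rewrite ?inE //; exact: measurableI.
apply: filterS2 lo hi => w /= /negP; rewrite -leNgt => -> /negP; rewrite -leNgt => ->.
by [].
Qed.

Lemma expect_indic_integral (A : set Omega) (f : Omega -> R) : measurable A ->
  expect (fun w => \1_A w * f w) = fine (\int[P]_(w in A) (f w)%:E)%E.
Proof.
move=> mA; rewrite /Rintegral [in RHS]integral_mkcond; congr fine.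
apply: eq_integral => w _; rewrite patchE indicE.
by case: (w \in A); rewrite ?mul1r ?mul0r.
Qed.

Theorem conditional_slln (G : nat -> set (set Omega)) (x : nat -> Omega -> bool)
    (rho : nat -> Omega -> R) :
  (forall k, G k `<=` measurable) -> (forall k, G k `<=` G k.+1) ->
  (forall k, <<s G k.+1 >> [set w | x k w]) ->
  (forall k, is_cond_prob P <<s G k >> [set w | x k w] (rho k)) ->
  {ae P, forall w, (forall m : R, exists t, m < compensator rho t w) ->
    (\sum_(k < t) (x k w)%:R) / compensator rho t w @[t --> \oo] --> (1 : R)}.
Proof.
move=> GM Gmono xG cond.
have mx k : measurable [set w | x k w] by exact: generated_measurable (xG k).
have ae01 := ae_foralln (fun k => cond_prob_ae01 (GM k) (mx k) (cond k)).
(* The bounds hold only almost surely for [rho], but everywhere for its clipped version, which is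
   still adapted and has the same integrals over events. *)
pose r k w := Num.min 1 (Num.max 0 (rho k w)).
have r01 k w : 0 <= r k w <= 1.
  by rewrite /r le_min ler01 le_max lexx /= ge_min lexx.
have rE k w : 0 <= rho k w <= 1 -> r k w = rho k w.
  by move=> /andP[h0 h1]; rewrite /r (max_idPr h0) (min_idPr h1).
have rhoA k : adapted (G k) (rho k) by apply: adaptedP; have [] := cond k.
have rA k : adapted (G k) (r k).
  apply: (@measurable_minr _ (g_sigma_algebraType (G k)) R setT (cst 1)
    (cst 0 \max rho k)) => //.
  apply: (@measurable_maxr _ (g_sigma_algebraType (G k))) => //.
  exact: rhoA.
have centered k A : <<s G k >> A -> expect (fun w => \1_A w * ((x k w)%:R - r k w)) = 0.
  move=> GA; have mA := generated_measurable (GM k) GA.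
  have bx := @bounded_measurable_indic R _ _ _ (mx k).
  have br : bounded_measurable (r k).
    split; first exact: adapted_measurable (GM k) _ (rA k).
    by exists 1 => w; have /andP[h0 h1] := r01 k w; rewrite ger0_norm.
  have ibx := integrableS measurableT mA (@subsetT _ A) (bounded_measurable_integrable P bx).
  have ibr := integrableS measurableT mA (@subsetT _ A) (bounded_measurable_integrable P br).
  rewrite expect_indic_integral // integralB_EFin //.
  have -> : (\int[P]_(w in A) ((x k w)%:R)%:E = P (A `&` [set w | x k w]))%E.
    rewrite setIC -integral_indic //; apply: eq_integral => w _.
    rewrite indicE; congr (_%:R)%:E; congr nat_of_bool.
    by apply/idP/idP; rewrite inE.
  have -> : (\int[P]_(w in A) (r k w)%:E = \int[P]_(w in A) (rho k w)%:E)%E.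
    have [_ irho _] := cond k.
    apply: ae_eq_integral => //.
    - exact: measurable_int ibr.
    - by apply: measurable_funTS; exact: measurable_int irho.
    by apply: filterS ae01 => w hw _; rewrite rE.
  have [_ _ ->] := cond k => //.
  by rewrite subee // fin_num_measure //; exact: measurableI.
have main := adapted_slln GM Gmono xG rA r01 centered.
apply: filterS2 main ae01 => w hw h01.
have cE t : compensator r t w = compensator rho t w.
  by apply: eq_bigr => k _; exact: rE.
move=> Sinf.
have -> : (fun t => (\sum_(k < t) (x k w)%:R) / compensator rho t w) =
    (fun t => (\sum_(k < t) (x k w)%:R) / compensator r t w).
  by apply/funext => t; rewrite cE.
by apply: hw => m; have [t mt] := Sinf m; exists t; rewrite cE.
Qed.
End ConditionalLaw.

(** * Convergence to equilibria *)

(** The generators of [history]: [<<s history_events X a b t >>] is [history X a b t] by conversion,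
    which lets [activation_prob] be passed to [conditional_slln]. *)
Definition history_events (n : nat) (Y : finType) (Omega : Type)
    (X : nat -> 'I_n -> Omega -> bool) (a b : nat -> 'I_n -> Omega -> Y)
    (t : nat) : set (set Omega) :=
  [set E | exists (s : nat) (i : 'I_n), (1 <= s <= t)%N /\
        [\/ exists y, E = [set w | a s i w = y],
            E = [set w | X s i w] |
            exists y, E = [set w | b s i w = y]]].

Section Deliberate.
Context {R : realType} {n : nat} {Y : finType} {d : measure_display}.
Context {Omega : measurableType d} (P : probability Omega R) (u : utilities R n Y).
Context (f : 'I_n -> profile R n Y -> strategy R Y) (eta : nat -> R).
Context (X : nat -> 'I_n -> Omega -> bool) (a b : nat -> 'I_n -> Omega -> Y).
Context (rho : nat -> 'I_n -> Omega -> R).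
Context (variant : strongly_convergent_ECFP P u f eta X a b rho).

Lemma deliberate_slln i : {ae P, forall w,
  \sum_(1 <= k < t.+1) rho k i w @[t --> \oo] --> +oo ->
  (num_deliberate X t i w)%:R / \sum_(1 <= k < t.+1) rho k i w @[t --> \oo] --> (1 : R)}.
Proof.
have GM k : history_events X a b k `<=` measurable.
  move=> E [s [j [/andP[s1 _] [[y ->]|->|[y ->]]]]].
  - exact: measurable_actions variant _ _ _ s1.
  - exact: measurable_activations variant _ _ s1.
  - exact: measurable_selections variant _ _ _ s1.
have Gmono k : history_events X a b k `<=` history_events X a b k.+1.
  move=> E [s [j [/andP[s1 sk] h]]]; exists s, j; split => //.
  by rewrite s1 ltnW.
(* Index [k] of the law of large numbers stands for round [k.+1], whose past is the history up to
   round [k]. *)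
have := @conditional_slln R d Omega P (history_events X a b) (fun k => X k.+1 i)
  (fun k => rho k.+1 i) GM Gmono.
have xG k : <<s history_events X a b k.+1 >> [set w | X k.+1 i w].
  apply: sub_sigma_algebra; exists k.+1, i; split; first by rewrite leqnn.
  by apply: Or32.
move=> /(_ xG (fun k => @activation_prob _ _ _ _ _ _ _ _ _ _ _ _ _ variant k.+1 i isT)).
apply: filterS => w h Sinf.
have SE t : compensator (fun k => rho k.+1 i) t w = \sum_(1 <= k < t.+1) rho k i w.
  by rewrite big_add1 /= big_mkord.
have LE t : \sum_(k < t) (X k.+1 i w)%:R = (num_deliberate X t i w)%:R :> R.
  by rewrite /num_deliberate big_add1 /= big_mkord natr_sum.
have -> : (fun t => (num_deliberate X t i w)%:R / \sum_(1 <= k < t.+1) rho k i w) =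
    (fun t => (\sum_(k < t) (X k.+1 i w)%:R) / compensator (fun k => rho k.+1 i) t w).
  by apply/funext => t; rewrite SE LE.
apply: h => m.
have /cvgryPgt /(_ m) [N _ HN] := Sinf.
by exists N; rewrite SE; apply: HN => /=.
Qed.

End Deliberate.

Section Ratios.
Context {R : realType} {n : nat} (l : nat -> 'I_n -> nat) (S : nat -> 'I_n -> R).
Context (S_pinfty : forall i, S t i @[t --> \oo] --> +oo).
Context (S_ratio : forall i j, S t i / S t j @[t --> \oo] --> (1 : R)).
Context (l_S : forall i, (l t i)%:R / S t i @[t --> \oo] --> (1 : R)).

Lemma ratio_cvg1 i j : (l t i)%:R / (l t j)%:R @[t --> \oo] --> (1 : R).
Proof.
have h : (l t i)%:R / S t i * (S t i / S t j) * ((l t j)%:R / S t j)^-1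
    @[t --> \oo] --> (1 : R).
  rewrite -[X in _ --> X](_ : 1 * 1 * 1^-1 = 1); last by rewrite invr1 !mulr1.
  by apply: cvgM; [exact: cvgM|apply: cvgV => //; exact: oner_neq0].
(* The sums of the conditional probabilities cancel only where they are nonzero, which divergence
   ensures from some time on. *)
have /cvgryPgt /(_ 0) [N1 _ H1] := S_pinfty i.
have /cvgryPgt /(_ 0) [N2 _ H2] := S_pinfty j.
apply/cvgrPdist_lt => e e0; have /cvgrPdist_lt /(_ e e0) [N3 _ H3] := h.
exists (maxn N1 (maxn N2 N3)) => // t /=; rewrite !geq_max => /and3P[t1 t2 t3].
have Si : S t i != 0 by rewrite gt_eqF //; exact: H1.
have Sj : S t j != 0 by rewrite gt_eqF //; exact: H2.
have := H3 t t3; congr (`|_ - _| < _).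
by rewrite mulrA divfK // invfM invrK (mulrC _^-1) mulrA divfK.
Qed.

Lemma count_pinfty i (m : nat) : exists t, (m <= l t i)%N.
Proof.
have /cvgryPgt /(_ (2 * m%:R)) [N1 _ H1] := S_pinfty i.
have h2 : 0 < 1 / 2 :> R by lra.
have /cvgrPdist_lt /(_ _ h2) [N2 _ H2] := l_S i.
exists (maxn N1 N2); set t := maxn N1 N2.
have h1 : 2 * m%:R < S t i by apply: H1; rewrite /= leq_maxl.
have := H2 t (leq_maxr _ _); rewrite /= ltr_norml => /andP[_ h].
have S0 : 0 < S t i by apply: le_lt_trans h1; rewrite mulr_ge0.
have : 1 / 2 < (l t i)%:R / S t i by lra.
rewrite ltr_pdivlMr // => h3.
by rewrite -(ler_nat R); lra.
Qed.
End Ratios.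

(** * Distance to a set of profiles *)

Section Distance.
Context {R : realType} {n : nat} {Y : finType}.
Implicit Types p q : profile R n Y.

Definition profile_dist1 p q : R := \sum_i dist1 (p i) (q i).

Lemma sum_sqr_le (I : finType) (g : I -> R) : (forall i, 0 <= g i) ->
  \sum_i g i ^+ 2 <= (\sum_i g i) ^+ 2.
Proof.
move=> g0; suff : \sum_i g i ^+ 2 <= (\sum_i g i) ^+ 2 /\ 0 <= \sum_i g i by case.
elim/big_rec2: _ => [|i x y _ [h y0]]; first by rewrite expr0n.
have := g0 i => gi; split; last exact: addr_ge0.
rewrite sqrrD mulr2n; have : 0 <= g i * x by rewrite mulr_ge0.
move: h; lra.
Qed.

Lemma euclidean_dist_le p q : euclidean_dist p q <= profile_dist1 p q.
Proof.
have d0 : 0 <= profile_dist1 p q by apply: sumr_ge0 => i _; exact: dist1_ge0.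
rewrite /euclidean_dist -[leRHS]ger0_norm // -sqrtr_sqr ler_wsqrtr //.
apply: le_trans (sum_sqr_le _) => [|i]; last exact: dist1_ge0.
apply: ler_sum => i _; apply: le_trans (sum_sqr_le _) => [|y]; last exact: normr_ge0.
by apply: ler_sum => y _; rewrite real_normK ?num_real.
Qed.

Lemma dist_to_cvg0 (g : nat -> profile R n Y) (S : set (profile R n Y)) :
  (forall delta, 0 < delta -> exists N, forall t, (N <= t)%N ->
    exists2 q, S q & profile_dist1 (g t) q < delta) ->
  dist_to (g t) S @[t --> \oo] --> 0%:E.
Proof.
move=> h.
have ge0 t : (0 <= dist_to (g t) S)%E.
  by apply: le_ereal_inf_tmp => _ [q _ <-]; rewrite lee_fin sqrtr_ge0.
have le_delta delta : 0 < delta -> exists N, forall t, (N <= t)%N ->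
    (dist_to (g t) S <= delta%:E)%E.
  move=> d0; have [N HN] := h delta d0; exists N => t /HN [q Sq dq].
  apply: (@le_trans _ _ (euclidean_dist (g t) q)%:E).
    by apply: ereal_inf_lbound; exists q.
  by rewrite lee_fin (le_trans (euclidean_dist_le _ _)) // ltW.
(* The distance is extended-real valued, so it has to be shown eventually finite before its real
   value is estimated; closeness 1 suffices for that. *)
apply/fine_cvgP; split.
  have [N HN] := le_delta 1 ltr01.
  exists N => // t /= Nt; rewrite ge0_fin_numE //.
  by apply: le_lt_trans (HN t Nt) _; exact: ltry.
apply: cvg0_of_lt => e e0.
have e2 : 0 < e / 2 by lra.
have [N HN] := le_delta _ e2; exists N => t Nt /=.
have fin : dist_to (g t) S \is a fin_num.
  by rewrite ge0_fin_numE //; apply: le_lt_trans (HN t Nt) _; exact: ltry.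
rewrite ger0_norm ?fine_ge0 //; apply: (@le_lt_trans _ _ (e / 2)); last lra.
by rewrite -lee_fin fineK // HN.
Qed.
End Distance.

(** * Equilibria as zeros of gaps *)

Section Equilibria.
Context {R : realType} {n : nat} {Y : finType} (u : utilities R n Y).
Context (i0 : 'I_n) (z0 : Y).
Context (u_identical : identical_utilities u).
Context (u_invariant : permutation_invariant u).

Let v := u i0.
Let W z x := deviation_value v i0 z x.
Let K := total_weight v * n%:R.

Lemma deviation_value_common i z x : deviation_value (u i) i z x = W z x.
Proof.
rewrite /W /v -(deviation_value_symmetric i0 i i0 z x u_invariant).
congr (deviation_value _ _ _ _); apply/funext => y; exact: u_identical.
Qed.

Lemma gap0_best_response (p x c : Y -> R) : simplex p -> simplex x ->
  gap z0 W p c = 0 -> \sum_z x z * W z c <= \sum_z p z * W z c.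
Proof.
move=> [p0 p1] [x0 x1] g0.
have -> : \sum_z p z * W z c = best_value z0 W c.
  by apply/eqP; rewrite eq_sym -subr_eq0 -sum_gap // g0.
apply: (@le_trans _ _ (\sum_z x z * best_value z0 W c)).
  by apply: ler_sum => z _; rewrite ler_wpM2l // le_best_value.
by rewrite -mulr_suml x1 mul1r.
Qed.

Lemma MCE_gap0 (p : profile R n Y) : mixed_profiles p ->
  (forall i, gap z0 W (p i) (centroid p) = 0) -> MCE u p.
Proof.
move=> sp g0; split => // i x sx; rewrite !(mixed_utility_deviate u i _ (centroid p)).
under eq_bigr do rewrite deviation_value_common.
under [leRHS]eq_bigr do rewrite deviation_value_common.
exact: gap0_best_response.
Qed.

Lemma centroid_const (x : Y -> R) : centroid (fun _ : 'I_n => x) = x.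
Proof.
apply/funext => y; rewrite /centroid sumr_const card_ord -[x y *+ n]mulr_natl mulrA.
by rewrite mulVf ?mul1r // pnatr_eq0 -lt0n (leq_ltn_trans _ (ltn_ord i0)).
Qed.

(** A constant profile is its own centroid, so for it the mean-centric condition is the Nash
    condition. *)
Lemma consensus_NE_gap0 (x : Y -> R) : simplex x -> gap z0 W x x = 0 ->
  consensus_NE u (fun=> x).
Proof.
move=> sx g0; have [|sp br] := @MCE_gap0 (fun=> x) (fun=> sx).
  by move=> i; rewrite centroid_const.
split => //; split => // i y sy; have := br i y sy.
by rewrite /centroid_profile centroid_const.
Qed.

Let I : finType := ('I_n * Y)%type.

(** Profiles are flattened to functions on pairs, so that [near_zero_set] applies to them. *)
Definition row_of (p : I -> R) : profile R n Y := fun i y => p (i, y).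

Lemma row_of_dist1 (p q : I -> R) i : dist1 (row_of p i) (row_of q i) <= dist1 p q.
Proof.
rewrite [leRHS](_ : _ = \sum_j dist1 (row_of p j) (row_of q j)).
  by rewrite (bigD1 i) //= lerDl sumr_ge0 // => j _; exact: dist1_ge0.
by rewrite /dist1 pair_bigA /=; apply: eq_bigr => -[].
Qed.

Lemma row_of_cube p i : cube p -> cube (row_of p i).
Proof. by move=> h y; exact: h. Qed.

Lemma centroid_cube (p : profile R n Y) : (forall i, cube (p i)) -> cube (centroid p).
Proof.
move=> h y; have n0 : 0 < n%:R :> R by rewrite ltr0n (leq_ltn_trans _ (ltn_ord i0)).
rewrite mulr_ge0 ?invr_ge0 ?ler0n ?sumr_ge0 //=; last first.
  by move=> i _; have /andP[] := h i y.
rewrite /centroid mulrC ler_pdivrMr // mul1r -[leRHS]mulr1.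
rewrite -[X in X%:R * 1]card_ord mulr_natl -sumr_const.
by apply: ler_sum => i _; have /andP[] := h i y.
Qed.

Lemma centroid_dist1 (p q : profile R n Y) (a : R) :
  (forall i, dist1 (p i) (q i) <= a) -> dist1 (centroid p) (centroid q) <= a.
Proof.
move=> h; have n0 : 0 < n%:R :> R by rewrite ltr0n (leq_ltn_trans _ (ltn_ord i0)).
apply: (@le_trans _ _ (\sum_(y : Y) n%:R^-1 * \sum_i `|p i y - q i y|)).
  apply: ler_sum => y _; rewrite -mulrBr normrM ger0_norm ?invr_ge0 ?ler0n //.
  by rewrite ler_wpM2l ?invr_ge0 ?ler0n // -sumrB ler_norm_sum.
rewrite -mulr_sumr exchange_big /= mulrC ler_pdivrMr //.
rewrite -[X in _ * X%:R]card_ord mulr_natr -sumr_const; apply: ler_sum => i _; exact: h.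
Qed.

(** As in [simplex_gap], the mass constraints are part of the function: its zeros in the cube are
    mixed profiles. *)
Definition mean_centric_gap (p : I -> R) : R :=
  \sum_i (`|\sum_y row_of p i y - 1| + gap z0 W (row_of p i) (centroid (row_of p))).

Lemma mean_centric_gap_lipschitz :
  lipschitz1 (n%:R * (1 + (2 * total_weight v + 2 * K * #|Y|%:R))) mean_centric_gap.
Proof.
move=> p q hp hq; rewrite /mean_centric_gap -sumrB.
apply: le_trans (ler_norm_sum _ _ _) _.
rewrite -mulrA -[X in X%:R * _]card_ord mulr_natl -sumr_const; apply: ler_sum => i _.
have -> (a b c e : R) : a + b - (c + e) = (a - c) + (b - e) by ring.
apply: le_trans (ler_normD _ _) _; rewrite mulrDl mul1r; apply: lerD.
  apply: le_trans (ler_dist_dist _ _) _.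
  rewrite opprB addrA subrK -sumrB; apply: le_trans (ler_norm_sum _ _ _) _.
  exact: row_of_dist1.
have rp j := row_of_cube j hp; have rq j := row_of_cube j hq.
apply: le_trans (gap_lipschitz z0 (deviation_value_lipschitz v i0)
  (deviation_value_bound v i0) (rp i) (rq i) (centroid_cube rp) (centroid_cube rq)) _.
rewrite [leRHS]mulrDl; apply: lerD.
  by rewrite ler_wpM2l ?mulr_ge0 ?total_weight_ge0 // row_of_dist1.
rewrite ler_wpM2l ?mulr_ge0 ?total_weight_ge0 //.
by apply: centroid_dist1 => j; exact: row_of_dist1.
Qed.

Lemma near_MCE delta : 0 < delta -> exists2 kappa, 0 < kappa &
  forall p : profile R n Y, mixed_profiles p ->
    \sum_i gap z0 W (p i) (centroid p) < kappa ->
    exists2 q, MCE u q & profile_dist1 p q < delta.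
Proof.
move=> d0; have [|kap kap0 Hk] := near_zero_set mean_centric_gap_lipschitz _ d0.
  move=> p hp; apply: sumr_ge0 => i _; rewrite addr_ge0 // gap_ge0 // => z.
  by have /andP[] := hp (i, z).
exists kap => // p sp gp.
pose p' (k : I) := p k.1 k.2.
have rp' : row_of p' = p by [].
have [k||q [cq gq dq]] := Hk p'.
- exact: simplex_cube (sp k.1) k.2.
- rewrite /mean_centric_gap rp'; apply: le_lt_trans gp; apply: ler_sum => i _.
  by rewrite (sp i).2 subrr normr0 add0r.
exists (row_of q).
  have q0 i y : 0 <= row_of q i y by have /andP[] := cq (i, y).
  have h i : `|\sum_y row_of q i y - 1| = 0 /\
      gap z0 W (row_of q i) (centroid (row_of q)) = 0.
    move/eqP: gq; rewrite psumr_eq0 => [/allP/(_ i)|j _]; last first.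
      by rewrite addr_ge0 ?gap_ge0.
    rewrite mem_index_enum => /(_ isT) /=.
    by rewrite paddr_eq0 ?gap_ge0 // => /andP[/eqP ? /eqP ?].
  apply: MCE_gap0 => i; last by have [] := h i.
  by split => //; apply/eqP; rewrite -subr_eq0 -normr_eq0; apply/eqP; have [] := h i.
apply: le_lt_trans dq; rewrite /profile_dist1 /dist1 pair_bigA /= le_eqVlt.
by apply/orP; left; apply/eqP; apply: eq_bigr => -[].
Qed.

End Equilibria.

Section Period.
Context {R : realType} {n : nat} {Y : finType} {Omega : Type}.
Context (f : 'I_n -> profile R n Y -> strategy R Y) (X : nat -> 'I_n -> Omega -> bool).
Context (a b : nat -> 'I_n -> Omega -> Y) (rho : nat -> 'I_n -> Omega -> R) (w : Omega).

(** The difference is rho times the difference of two points of the simplex, whose l1 distance is at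
    most 2. *)
Lemma period_strategy_dist t : (forall i, simplex (intermediate f X a t.-1 w i)) ->
  profile_dist1 (period_strategy f X a b rho t w) (intermediate f X a t.-1 w) <=
    \sum_i 2 * `|rho t i w|.
Proof.
move=> sxi; apply: ler_sum => i _.
apply: (@le_trans _ _ (`|rho t i w| *
    dist1 (pure R (b t.-1 i w)) (intermediate f X a t.-1 w i))).
  rewrite /dist1 mulr_sumr; apply: ler_sum => y _.
  rewrite -normrM /period_strategy le_eqVlt; apply/orP; left; apply/eqP.
  by congr (`|_|); ring.
by rewrite mulrC ler_wpM2r // (simplex_dist1 (simplex_pure R _) (sxi i)).
Qed.

(* Since the activation probabilities vanish, the period strategy inherits the
   limit set of the strategies drawn from in the other rounds. *)
Lemma period_strategy_cvg (S : set (profile R n Y)) :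
  (forall i, rho t i w @[t --> \oo] --> (0 : R)) ->
  (forall t i, (1 <= t)%N -> simplex (intermediate f X a t w i)) ->
  (forall delta, 0 < delta -> exists N, forall t, (N <= t)%N ->
    exists2 q, S q & profile_dist1 (intermediate f X a t w) q < delta) ->
  dist_to (period_strategy f X a b rho t w) S @[t --> \oo] --> 0%:E.
Proof.
move=> rho0 sxi h; apply: dist_to_cvg0 => delta d0.
have d2 : 0 < delta / 2 by lra.
have [N HN] := h _ d2.
have rho_sum0 : \sum_i 2 * `|rho t i w| @[t --> \oo] --> (0 : R).
  have := @cvg_sum_seq R 'I_n (index_enum 'I_n) (fun i t => 2 * `|rho t i w|) (fun=> 0).
  rewrite big1_eq; apply => i; rewrite -(mulr0 2); apply: cvgM; first exact: cvg_cst.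
  by rewrite -(normr0 R); apply: cvg_norm; exact: rho0.
have [M HM] := cvg0_lt rho_sum0 d2.
(* Round [t] draws from the strategies of time [t.-1], hence the successor of [N]; [t >= 2] puts
   [t.-1] in the range where these lie in the simplex. *)
exists (maxn N.+1 (maxn M 2)) => t; rewrite !geq_max => /and3P[Nt Mt t2].
have tN : (N <= t.-1)%N by rewrite -ltnS prednK // (leq_trans _ t2).
have [q Sq dq] := HN _ tN; exists q => //.
have t1 : (1 <= t.-1)%N by rewrite -ltnS prednK // (leq_trans _ t2).
have := HM t Mt; rewrite ger0_norm; last by apply: sumr_ge0 => i _; rewrite mulr_ge0.
have := period_strategy_dist (fun i => sxi t.-1 i t1).
set g := period_strategy _ _ _ _ _ _ _; set xi := intermediate _ _ _ _ _.
have : profile_dist1 g q <= profile_dist1 g xi + profile_dist1 xi q.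
  rewrite /profile_dist1 -big_split /=; apply: ler_sum => i _.
  rewrite /dist1 -big_split /=; apply: ler_sum => y _.
  exact: ler_distD.
by move: dq; rewrite -/xi; lra.
Qed.
End Period.

Unset Implicit Arguments.
Set Strict Implicit.

Theorem corollary3 (R : realType) (n : nat) (Y : finType)
    (u : utilities R n Y) (f : 'I_n -> profile R n Y -> strategy R Y)
    (d : measure_display) (Omega : measurableType d) (P : probability Omega R)
    (eta : nat -> R) (X : nat -> 'I_n -> Omega -> bool)
    (a b : nat -> 'I_n -> Omega -> Y) (rho : nat -> 'I_n -> Omega -> R)
    (n_gt0 : (0 < n)%N)
    (u_identical : identical_utilities u)
    (u_invariant : permutation_invariant u)
    (variant : strongly_convergent_ECFP P u f eta X a b rho)
    (rho_to0 : {ae P, forall w, forall i : 'I_n,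
       rho t i w @[t --> \oo] --> (0 : R)})
    (rho_sum : {ae P, forall w, forall i : 'I_n,
       \sum_(1 <= k < t.+1) rho k i w @[t --> \oo] --> +oo})
    (rho_ratio : {ae P, forall w, forall i j : 'I_n,
       (\sum_(1 <= k < t.+1) rho k i w) / (\sum_(1 <= k < t.+1) rho k j w)
         @[t --> \oo] --> (1 : R)})
    (eta_to0 : eta t @[t --> \oo] --> (0 : R)) :
  ((forall i q, mixed_profiles q -> f i q = centroid q) ->
     {ae P, forall w,
       dist_to (period_strategy f X a b rho t w) (consensus_NE u)
         @[t --> \oo] --> 0%:E}) /\
  ((forall i q, mixed_profiles q -> f i q = q i) ->
     {ae P, forall w,
       dist_to (period_strategy f X a b rho t w) (MCE u)
         @[t --> \oo] --> 0%:E}).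
Proof.
have ae_slln : {ae P, forall w, forall i : 'I_n,
    \sum_(1 <= k < t.+1) rho k i w @[t --> \oo] --> +oo ->
    (num_deliberate X t i w)%:R / \sum_(1 <= k < t.+1) rho k i w
      @[t --> \oo] --> (1 : R)}.
  apply: filter_forall => i; exact: deliberate_slln variant i.
pose i0 : 'I_n := Ordinal n_gt0.
(* The seed action of [best_value] is taken from the process itself, as [b 1 i0 w], since [Y] comes
   without a designated element. *)
have path w :
    (forall i : 'I_n, \sum_(1 <= k < t.+1) rho k i w @[t --> \oo] --> +oo) ->
    (forall i j : 'I_n,
      (\sum_(1 <= k < t.+1) rho k i w) / (\sum_(1 <= k < t.+1) rho k j w)
        @[t --> \oo] --> (1 : R)) ->
    (forall i : 'I_n, \sum_(1 <= k < t.+1) rho k i w @[t --> \oo] --> +oo ->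
      (num_deliberate X t i w)%:R / \sum_(1 <= k < t.+1) rho k i w
        @[t --> \oo] --> (1 : R)) ->
    self_gap (u i0) i0 (b 1 i0 w) (centroid (empirical R X a t w)) @[t --> \oo] --> 0.
  move=> hsum hratio hlaw.
  have l_S i := hlaw i (hsum i).
  apply: (@centroid_gap_to0 R n Y Omega u eta X a b w i0 (b 1 i0 w)) => //.
  - by move=> i; exact: initialization variant i w.
  - by move=> t i t2; exact: (selection variant _ _ t2).
  - by move=> t i t2; exact: (deliberate variant t2).
  - exact: (ratio_cvg1 hsum hratio l_S).
  - exact: (count_pinfty hsum l_S).
have emp w t : (1 <= t)%N -> mixed_profiles (empirical R X a t w).
  move=> t1; apply: empirical_simplex => // i; exact: initialization variant i w.
split=> f_eq.
  near=> w.
  have rho0 : forall i : 'I_n, rho t i w @[t --> \oo] --> (0 : R) by near: w.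
  have gap0 : self_gap (u i0) i0 (b 1 i0 w) (centroid (empirical R X a t w))
      @[t --> \oo] --> 0.
    by apply: path; near: w.
  have xiE t i : (1 <= t)%N -> intermediate f X a t w i = centroid (empirical R X a t w).
    by move=> t1; rewrite /intermediate f_eq //; exact: emp.
  apply: period_strategy_cvg => // [t i t1|delta d0].
    by rewrite xiE //; apply: centroid_simplex => //; exact: emp.
  have n1 : 0 < n%:R :> R by rewrite ltr0n.
  (* The tolerance is divided by [n] because the distance of the two constant profiles adds up [n]
     equal terms. *)
  have [kap kap0 Hk] := near_equilibrium (u i0) i0 (b 1 i0 w) (divr_gt0 d0 n1).
  have [N HN] := cvg0_lt gap0 kap0.
  exists (maxn N 1) => t; rewrite geq_max => /andP[Nt t1].
  have [|q [sq gq dq]] := Hk _ (centroid_simplex n_gt0 (emp w t t1)).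
    by have := HN t Nt; apply: le_lt_trans; exact: ler_norm.
  exists (fun=> q); first exact: consensus_NE_gap0 gq.
  rewrite /profile_dist1 (eq_bigr (fun=> dist1 (centroid (empirical R X a t w)) q)); last first.
    by move=> i _; rewrite xiE.
  by rewrite sumr_const card_ord -mulr_natr -ltr_pdivlMr.
near=> w.
have rho0 : forall i : 'I_n, rho t i w @[t --> \oo] --> (0 : R) by near: w.
have gap0 : self_gap (u i0) i0 (b 1 i0 w) (centroid (empirical R X a t w))
    @[t --> \oo] --> 0.
  by apply: path; near: w.
have xiE t : (1 <= t)%N -> intermediate f X a t w = empirical R X a t w.
  by move=> t1; apply/funext => i; rewrite /intermediate f_eq //; exact: emp.
apply: period_strategy_cvg => // [t i t1|delta d0].
  by rewrite xiE //; exact: emp.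
have [kap kap0 Hk] := near_MCE i0 (b 1 i0 w) u_identical u_invariant d0.
(* One factor [n] bounds the gap of a single [q i] by that of the centroid; the other comes from
   summing over the players. *)
have nn : 0 < n%:R * n%:R :> R by rewrite mulr_gt0 ?ltr0n.
have [N HN] := cvg0_lt gap0 (divr_gt0 kap0 nn).
exists (maxn N 1) => t; rewrite geq_max => /andP[Nt t1].
rewrite xiE //; apply: Hk; first exact: emp.
have := HN t Nt; rewrite ger0_norm; last first.
  by apply: gap_ge0; exact: (centroid_simplex n_gt0 (emp w t t1)).1.
rewrite ltr_pdivlMr //; apply: le_lt_trans.
set q := empirical R X a t w.
apply: (@le_trans _ _ (\sum_(i < n) n%:R * self_gap (u i0) i0 (b 1 i0 w) (centroid q))).
  apply: ler_sum => i _; apply: gap_monotone => z.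
  rewrite /centroid mulrA mulfV ?mul1r ?pnatr_eq0 -?lt0n //.
  rewrite (bigD1 i) //= lerDl; apply: sumr_ge0 => j _.
  exact: (emp w t t1 j).1.
rewrite sumr_const card_ord -[leLHS]mulr_natr.
by rewrite -mulrA mulrCA.
Unshelve. all: by end_near.
Qed.
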